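(* Let $A$ and $B$ be unital complex Banach algebras, and let $\Phi\colon A\to B$ be a surjective Lie homomorphism. Suppose that neither $A$ nor $B$ has a quotient isomorphic to $\mathbb{C}$ or $M_2(\mathbb{C})$, and further suppose that $B$ is semisimple. Then $\Phi=\Theta+\zeta$, where $\Theta\colon A\to B$ is a surjective direct sum of a homomorphism and the negative of an anti-homomorphism, and $\zeta\colon A\to\mathcal{Z}(B)$ is an additive mapping vanishing on commutators.
   Context: Notation: $[x,y]=xy-yx$ and $\mathcal{Z}(B)$ is the center of $B$. Mappings are additive, not necessarily linear. A Lie homomorphism is an additive mapping $\Phi\colon A\to B$ with $\Phi([x,y])=[\Phi(x),\Phi(y)]$ for all $x,y\in A$. An additive mapping $\Theta\colon A\to B$ is the direct sum of a homomorphism and the negative of an anti-homomorphism if there exists a central idempotent $e\in B$ such that $e\Theta(xy)=e\Theta(x)\Theta(y)$ and $(1-e)\Theta(xy)=-(1-e)\Theta(y)\Theta(x)$ for all $x,y\in A$. The mapping $\zeta$ vanishes on commutators if $\zeta([x,y])=0$ for all $x,y\in A$. A quotient of an algebra is a quotient by a two-sided ideal, and isomorphisms of quotients are isomorphisms of complex algebras. Semisimple means that the Jacobson radical is zero. *)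

(* Defs.v *)
From HB Require Import structures.
From mathcomp Require Import all_boot all_order all_algebra.
From mathcomp Require Import generic_quotient ring_quotient.
From mathcomp Require Import complex.
From mathcomp Require Import boolp classical_sets functions reals.
From mathcomp Require Import topology normedtype.

Set Implicit Arguments.
Unset Strict Implicit.
Unset Printing Implicit Defensive.

Import Order.TTheory GRing.Theory Num.Theory.
Import numFieldNormedType.Exports.

Local Open Scope classical_set_scope.
Local Open Scope quotient_scope.
Local Open Scope ring_scope.

(* HB admits no join of the ring and the normed-space hierarchies outside of  *)
(* the numeric structures, so the norm of a Banach algebra is transported     *)
(* along a linear bijection onto a Banach space: the norm of x is             *)
(* `|to_space x|. The norm of 1 is not required to be 1.                      *)
Record banachAlgType (K : numFieldType) := BanachAlgType {
  banach_alg :> algType K;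
  banach_space : completeNormedModType K;
  to_space : {linear banach_alg -> banach_space};
  to_space_bij : bijective to_space;
  to_space_normM : forall x y : banach_alg,
    `|to_space (x * y)| <= `|to_space x| * `|to_space y|
}.

(* The library idealr is a proper subset closed under multiplication on the   *)
(* left by ring elements. Properness only excludes the zero quotient.         *)
HB.mixin Record isMulrClosedIdeal (A : nzRingType) (I : A -> bool) := {
  ideal_mulr : forall a x : A, x \in I -> x * a \in I
}.

#[short(type="twoSidedIdeal")]
HB.structure Definition TwoSidedIdeal (A : nzRingType) :=
  {I of Idealr A I & isMulrClosedIdeal A I}.

(* ring_quotient only equips quotients of commutative rings with a ring       *)
(* structure; the alias keeps its canonical instances on {ideal_quot I} out.  *)
Definition quotient_algebra (A : nzRingType) (I : twoSidedIdeal A) : Type :=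
  {ideal_quot I}.

Section QuotientRing.
Variables (A : nzRingType) (I : twoSidedIdeal A).
Local Notation Q := (quotient_algebra I).

HB.instance Definition _ := GRing.Zmodule.on Q.

Definition qa_pi (x : A) : Q := \pi_{ideal_quot I} x.

Lemma qa_piP (q : Q) : {x | q = qa_pi x}.
Proof. by exists (repr (q : {ideal_quot I})); rewrite /qa_pi reprK. Qed.

Lemma qa_pi_eq x y : (qa_pi x = qa_pi y) <-> (x - y \in I).
Proof.
by rewrite Quotient.idealrBE; split=> [/eqP|/eqP].
Qed.

Lemma qa_piD : {morph qa_pi : x y / x + y}.
Proof. by move=> x y; rewrite /qa_pi raddfD. Qed.

Definition qa_one : Q := qa_pi 1.
Definition qa_mul (p q : Q) : Q :=
  qa_pi (repr (p : {ideal_quot I}) * repr (q : {ideal_quot I})).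

Lemma qa_piM : {morph qa_pi : x y / x * y >-> qa_mul x y}.
Proof.
move=> x y; apply/qa_pi_eq.
have reprB z : z - repr (qa_pi z : {ideal_quot I}) \in I.
  by apply/qa_pi_eq; rewrite /qa_pi reprK.
set x' := repr _; set y' := repr _.
have -> : x * y - x' * y' = (x - x') * y + x' * (y - y').
  by rewrite mulrBl mulrBr addrA subrK.
apply: rpredD; first exact/ideal_mulr/reprB.
exact/idealMr/reprB.
Qed.

Lemma qa_mulA : associative qa_mul.
Proof.
move=> p q r; case: (qa_piP p) (qa_piP q) (qa_piP r) => [x ->] [y ->] [z ->].
by rewrite -!qa_piM mulrA.
Qed.

Lemma qa_mul1 : left_id qa_one qa_mul.
Proof. by move=> p; case: (qa_piP p) => x ->; rewrite -qa_piM mul1r. Qed.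

Lemma qa_mulr1 : right_id qa_one qa_mul.
Proof. by move=> p; case: (qa_piP p) => x ->; rewrite -qa_piM mulr1. Qed.

Lemma qa_mulDl : left_distributive qa_mul +%R.
Proof.
move=> p q r; case: (qa_piP p) (qa_piP q) (qa_piP r) => [x ->] [y ->] [z ->].
by rewrite -qa_piD -!qa_piM -qa_piD mulrDl.
Qed.

Lemma qa_mulDr : right_distributive qa_mul +%R.
Proof.
move=> p q r; case: (qa_piP p) (qa_piP q) (qa_piP r) => [x ->] [y ->] [z ->].
by rewrite -qa_piD -!qa_piM -qa_piD mulrDr.
Qed.

Lemma qa_one_neq0 : qa_one != 0.
Proof.
apply/eqP => q10; suff : (1 : A) \in I by rewrite idealr1.
by rewrite -[1]subr0; apply/qa_pi_eq; rewrite -/qa_one q10 /qa_pi raddf0.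
Qed.

HB.instance Definition _ := GRing.Zmodule_isNzRing.Build Q
  qa_mulA qa_mul1 qa_mulr1 qa_mulDl qa_mulDr qa_one_neq0.

End QuotientRing.

Section QuotientAlgebra.
Variables (K : pzRingType) (A : algType K) (I : twoSidedIdeal A).
Local Notation Q := (quotient_algebra I).

Definition qa_scale (k : K) (q : Q) : Q := qa_pi I (k *: repr (q : {ideal_quot I})).

Lemma qa_piZ k (x : A) : qa_pi I (k *: x) = qa_scale k (qa_pi I x).
Proof.
apply/qa_pi_eq; rewrite -scalerBr -[_ - _]mul1r scalerAl idealMr //.
by apply/qa_pi_eq; rewrite /qa_pi reprK.
Qed.

Lemma qa_scaleA a b q : qa_scale a (qa_scale b q) = qa_scale (a * b) q.
Proof. by case: (qa_piP q) => x ->; rewrite -!qa_piZ scalerA. Qed.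

Lemma qa_scale1 : left_id 1 qa_scale.
Proof. by move=> q; case: (qa_piP q) => x ->; rewrite -qa_piZ scale1r. Qed.

Lemma qa_scaleDr : right_distributive qa_scale +%R.
Proof.
move=> a p q; case: (qa_piP p) (qa_piP q) => [x ->] [y ->].
by rewrite -qa_piD -!qa_piZ -qa_piD scalerDr.
Qed.

Lemma qa_scaleDl q : {morph qa_scale^~ q : a b / a + b}.
Proof.
by move=> a b; case: (qa_piP q) => x ->; rewrite -!qa_piZ -qa_piD scalerDl.
Qed.

HB.instance Definition _ := GRing.Zmodule_isLmodule.Build K Q
  qa_scaleA qa_scale1 qa_scaleDr qa_scaleDl.

Lemma qa_scaleAl (k : K) (p q : Q) : k *: (p * q) = (k *: p) * q.
Proof.
case: (qa_piP p) (qa_piP q) => [x ->] [y ->]; rewrite /GRing.mul/= /GRing.scale/=.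
by rewrite -qa_piM -!qa_piZ -qa_piM scalerAl.
Qed.

Lemma qa_scaleAr (k : K) (p q : Q) : k *: (p * q) = p * (k *: q).
Proof.
case: (qa_piP p) (qa_piP q) => [x ->] [y ->]; rewrite /GRing.mul/= /GRing.scale/=.
by rewrite -qa_piM -!qa_piZ -qa_piM scalerAr.
Qed.

HB.instance Definition _ := GRing.Lmodule_isLalgebra.Build K Q qa_scaleAl.
HB.instance Definition _ := GRing.Lalgebra_isAlgebra.Build K Q qa_scaleAr.

End QuotientAlgebra.

Definition algebra_isomorphic (K : pzRingType) (A B : algType K) : Prop :=
  exists f : {lrmorphism A -> B}, bijective f.

Definition has_quotient_isomorphic_to (K : pzRingType) (A D : algType K) :
    Prop :=
  exists I : twoSidedIdeal A, algebra_isomorphic (quotient_algebra I) D.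

Section Rings.
Variable A : pzRingType.

Definition lie_bracket (x y : A) : A := x * y - y * x.

Definition ring_center : set A := [set z | forall x, z * x = x * z].

(* Closure under opposites follows from multiplication by -1.                 *)
Definition left_ideal (L : set A) : Prop :=
  [/\ L 0, forall x y, L x -> L y -> L (x + y) & forall a x, L x -> L (a * x)].

Definition maximal_left_ideal (L : set A) : Prop :=
  [/\ left_ideal L, L <> setT &
      forall M, left_ideal M -> L `<=` M -> M = L \/ M = setT].

Definition jacobson_radical : set A := \bigcap_(L in maximal_left_ideal) L.

Definition semisimple : Prop := jacobson_radical = [set 0].

End Rings.

Arguments ring_center A : clear implicits.
Arguments jacobson_radical A : clear implicits.
Arguments semisimple A : clear implicits.

Section Mappings.
Variables A B : pzRingType.

Definition lie_homomorphism (f : {additive A -> B}) : Prop :=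
  forall x y, f (lie_bracket x y) = lie_bracket (f x) (f y).

Definition direct_sum_hom_neg_antihom (f : {additive A -> B}) : Prop :=
  exists e : B, [/\ ring_center B e, e * e = e &
    forall x y, e * f (x * y) = e * f x * f y /\
                (1 - e) * f (x * y) = - ((1 - e) * f y * f x)].

Definition vanishes_on_commutators (f : {additive A -> B}) : Prop :=
  forall x y, f (lie_bracket x y) = 0.

End Mappings.

(* Main.v *)
Require Import Defs.
From HB Require Import structures.
From mathcomp Require Import all_boot all_order all_algebra.
From mathcomp Require Import generic_quotient ring_quotient.
From mathcomp Require Import cyclic separable cyclotomic.
From mathcomp Require Import complex ring lra.
From mathcomp Require Import boolp classical_sets functions reals.
From mathcomp Require Import topology normedtype derive.

Import Order.TTheory GRing.Theory Num.Theory.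
Import numFieldNormedType.Exports.

Local Open Scope classical_set_scope.
Local Open Scope ring_scope.

Set Implicit Arguments.
Unset Strict Implicit.
Unset Printing Implicit Defensive.

(** The additive maps Q(x,y) = Phi(xy + yx) satisfy
      [Q(x,y), Phi z] + [Q(y,z), Phi x] + [Q(z,x), Phi y] = 0,
    because the same cyclic sum of [xy + yx, z] vanishes in A and Phi preserves
    brackets.  So x |-> Q(x,x) commutes with x |-> Phi x, and the heart of the
    matter is that such a commuting trace has the form
      Q(x,y) = l (Phi x Phi y + Phi y Phi x) + mu(x) Phi y + mu(y) Phi x + N(x,y)
    with central l, mu(x), N(x,y) ([commuting_trace_standard]).

    This fails when elements of B are quadratic over the centre; the obstruction
    is measured by the elements [t^2,u] v [t,w] - [t,u] v [t^2,w], the quadratic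
    defects of t.  Such a defect is E(t^2) for a two-sided multiplication operator
    E that kills 1 and t, so applying E to a functional identity in which t, t^2
    were introduced by substitution isolates one coefficient, multiplied by the
    defect.  The elements c for which the identity can be solved after
    multiplication by c form a two-sided ideal; hence if the defects generate B as
    an ideal, c = 1 is allowed and the identity is solved inside B, without any
    extended centroid ([commuting_one_sided]).

    Given the standard form, the Jordan identity [[x,z],y] = x o (y o z) -
    (x o y) o z, with x o y = xy + yx, forces l^2 = 1 and relates N to mu; here
    semisimplicity of B enters, through the absence of nilpotent ideals.  Completing
    the square, Theta = Phi + l mu / 2 satisfies Theta(x o y) = l Theta x o Theta y
    and Theta [x,y] = [Theta x, Theta y], so that Theta is multiplicative on the
    part of B cut out by e = (1 + l) / 2 and minus an antihomomorphism on the
    complementary part ([lie_homomorphism_decomposition]).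

    It remains to see that the defects generate B ([quad_defects_generate]).
    Otherwise they lie in a maximal two-sided ideal M.  The quotient B / M is
    simple, and its centre is C by the Gelfand-Mazur theorem applied to the quotient
    seminorm, which does not vanish at 1 because elements close to 1 are invertible.
    All its defects vanish, which makes every element quadratic over C, and a
    simple algebra with centre C and this property is C or M_2(C)
    ([quadratic_simple_iso]), contrary to the hypotheses on the quotients of B. *)

(** * Equality in noncommutative rings by normalization *)

(** The identities below live in a noncommutative ring with a few central
    elements.  Both sides are expanded into formal sums of words, in which the
    central letters are kept apart and sorted, and the resulting multisets of
    words are compared. *)
Section NormalForms.
Variable R : pzRingType.

Inductive ring_word :=
| WZero | WOne | WVar of nat | WCen of nat
| WAdd of ring_word & ring_word | WOpp of ring_word
| WMul of ring_word & ring_word.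

(** The words that occur in the expansion of [e] with sign plus, for [s = true],
    or minus, for [s = false]; a word is a pair of a central and a noncentral
    part.  Nothing is cancelled here: opposite words meet in [word_eq]. *)
Fixpoint monomials (s : bool) (e : ring_word) : seq (seq nat * seq nat) :=
  match e with
  | WZero => [::]
  | WOne => if s then [:: ([::], [::])] else [::]
  | WVar i => if s then [:: ([::], [:: i])] else [::]
  | WCen i => if s then [:: ([:: i], [::])] else [::]
  | WAdd a b => monomials s a ++ monomials s b
  | WOpp a => monomials (~~ s) a
  | WMul a b =>
    let mul m n := (sort leq (m.1 ++ n.1), m.2 ++ n.2) in
    [seq mul m n | m <- monomials s a, n <- monomials true b] ++
    [seq mul m n | m <- monomials (~~ s) a, n <- monomials false b]
  end.

Lemma ring_center0 : ring_center R 0.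
Proof. by move=> x; rewrite mul0r mulr0. Qed.

Variables (vars : seq R) (cens : seq {z | ring_center R z}).

Definition cen_val i := sval (nth (exist _ 0 ring_center0) cens i).

Fixpoint word_val (e : ring_word) : R :=
  match e with
  | WZero => 0
  | WOne => 1
  | WVar i => nth 0 vars i
  | WCen i => cen_val i
  | WAdd a b => word_val a + word_val b
  | WOpp a => - word_val a
  | WMul a b => word_val a * word_val b
  end.

Definition monomial_val (m : seq nat * seq nat) : R :=
  (\prod_(i <- m.1) cen_val i) * (\prod_(i <- m.2) nth 0 vars i).

Lemma cen_prod_comm s (x : R) :
  (\prod_(i <- s) cen_val i) * x = x * \prod_(i <- s) cen_val i.
Proof.
elim: s => [|i s IH]; first by rewrite !big_nil mulr1 mul1r.
rewrite !big_cons -mulrA IH mulrA [RHS]mulrA; congr (_ * _).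
exact: (svalP (nth (exist _ 0 ring_center0) cens i)).
Qed.

Lemma cen_prod_perm s t : perm_eq s t ->
  \prod_(i <- s) cen_val i = \prod_(i <- t) cen_val i.
Proof.
elim: s t => [|i s IH] t; first by rewrite perm_sym => /perm_nilP ->.
move=> /[dup] /perm_mem/(_ i); rewrite mem_head => /esym it.
case/splitPr: it => t1 t2.
rewrite perm_sym (perm_catCA t1 [:: i] t2) /= perm_cons perm_sym => /IH e.
by rewrite big_cons e !big_cat /= big_cons mulrA -(cen_prod_comm t1) mulrA.
Qed.

Lemma monomial_valM m n :
  monomial_val (sort leq (m.1 ++ n.1), m.2 ++ n.2) =
  monomial_val m * monomial_val n.
Proof.
rewrite /monomial_val /= (@cen_prod_perm _ (m.1 ++ n.1)) ?perm_sort //.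
by rewrite !big_cat /= -!mulrA; congr (_ * _); rewrite mulrA cen_prod_comm mulrA.
Qed.

Lemma word_valE e :
  word_val e = \sum_(m <- monomials true e) monomial_val m -
               \sum_(m <- monomials false e) monomial_val m.
Proof.
elim: e => [||i|i|a IHa b IHb|a IHa|a IHa b IHb] /=.
- by rewrite !big_nil subr0.
- by rewrite big_seq1 big_nil subr0 /monomial_val !big_nil mulr1.
- by rewrite big_seq1 big_nil subr0 /monomial_val big_nil big_seq1 mul1r.
- by rewrite big_seq1 big_nil subr0 /monomial_val big_nil big_seq1 mulr1.
- by rewrite IHa IHb !big_cat /= opprD addrACA.
- by rewrite IHa opprB.
have prodE (u v : seq (seq nat * seq nat)) :
    \sum_(m <- [seq (sort leq (m.1 ++ n.1), m.2 ++ n.2) | m <- u, n <- v])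
      monomial_val m =
    (\sum_(m <- u) monomial_val m) * (\sum_(m <- v) monomial_val m).
  rewrite big_allpairs_dep /= mulr_suml; apply: eq_bigr => m _.
  by rewrite mulr_sumr; apply: eq_bigr => n _; rewrite monomial_valM.
rewrite IHa IHb !big_cat /= !prodE mulrBl !mulrBr.
by rewrite opprB opprD (addrC (- _)) addrACA.
Qed.

(** Moving the negative words of each side to the other side makes the comparison
    one of multisets, whatever cancellations take place inside a side. *)
Lemma word_eq a b :
  perm_eq (monomials true a ++ monomials false b)
          (monomials true b ++ monomials false a) ->
  word_val a = word_val b.
Proof.
move=> h; rewrite !word_valE.
have {h} : \sum_(m <- monomials true a ++ monomials false b) monomial_val m =
           \sum_(m <- monomials true b ++ monomials false a) monomial_val m.
  exact: perm_big.
rewrite !big_cat /= => h.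
by apply/eqP; rewrite subr_eq addrAC -h addrK.
Qed.

End NormalForms.

Ltac nc_index x l :=
  lazymatch l with
  | x :: _ => constr:(O)
  | _ :: ?t => let n := nc_index x t in constr:(S n)
  end.

Ltac nc_mem x l :=
  lazymatch l with
  | x :: _ => constr:(true)
  | _ :: ?t => nc_mem x t
  | _ => constr:(false)
  end.

Ltac nc_atoms t cs l :=
  lazymatch t with
  | (?a + ?b)%R => let l := nc_atoms a cs l in nc_atoms b cs l
  | (?a * ?b)%R => let l := nc_atoms a cs l in nc_atoms b cs l
  | (- ?a)%R => nc_atoms a cs l
  | (0)%R => l
  | (1)%R => l
  | _ => lazymatch nc_mem t cs with
         | true => l
         | false => lazymatch nc_mem t l with
                    | true => l
                    | false => constr:(t :: l)
                    end
         end
  end.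

Ltac nc_reify t cs l :=
  lazymatch t with
  | (?a + ?b)%R => let u := nc_reify a cs l in
                   let v := nc_reify b cs l in constr:(WAdd u v)
  | (?a * ?b)%R => let u := nc_reify a cs l in
                   let v := nc_reify b cs l in constr:(WMul u v)
  | (- ?a)%R => let u := nc_reify a cs l in constr:(WOpp u)
  | (0)%R => constr:(WZero)
  | (1)%R => constr:(WOne)
  | _ => lazymatch nc_mem t cs with
         | true => let n := nc_index t cs in constr:(WCen n)
         | false => let n := nc_index t l in constr:(WVar n)
         end
  end.

Ltac nc_cens R cs :=
  lazymatch cs with
  | (?cs', ?h) =>
    lazymatch type of h with
    | ring_center _ ?z =>
      let l := nc_cens R cs' in constr:(exist (ring_center R) z h :: l)
    end
  | tt => constr:(@nil {z : R | ring_center R z})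
  end.

Ltac nc_cen_vals R cs :=
  lazymatch cs with
  | (?cs', ?h) =>
    lazymatch type of h with
    | ring_center _ ?z => let l := nc_cen_vals R cs' in constr:(z :: l)
    end
  | tt => constr:(@nil R)
  end.

Ltac nc_ring_with cs :=
  rewrite /lie_bracket;
  lazymatch goal with
  | |- @eq ?T ?a ?b =>
    let vs := nc_cen_vals T cs in
    let ps := nc_cens T cs in
    let l := nc_atoms a vs (@nil T) in
    let l := nc_atoms b vs l in
    let u := nc_reify a vs l in
    let v := nc_reify b vs l in
    apply: (@word_eq _ l ps u v); vm_compute; reflexivity
  end.

(** In [nc_ring (tt, h1, .., hn)] the [hi] are proofs that some of the subterms
    are central. *)
Tactic Notation "nc_ring" := nc_ring_with tt.
Tactic Notation "nc_ring" constr(cs) := nc_ring_with cs.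


(** Turns a linear combination of known equations, [c = d], into an equation
    that differs from it by a ring identity. *)
Lemma eq_of_diff (V : zmodType) (a b c d : V) : c = d -> a - b = c - d -> a = b.
Proof. by move=> ->; rewrite subrr => /eqP; rewrite subr_eq0 => /eqP. Qed.

(** * Quadratic defects and the operators that eliminate powers *)
Section Ideals.
Variable B : pzRingType.

Definition two_sided (I : set B) : Prop :=
  [/\ I 0, forall x y, I x -> I y -> I (x + y),
      forall a x, I x -> I (a * x) & forall a x, I x -> I (x * a)].

(** Quantifying over all ideals that contain [S] lets the generated ideal be used
    by exhibiting ideals, without ever writing 1 as a sum of products. *)
Definition generates (S : set B) : Prop :=
  forall I, two_sided I -> S `<=` I -> forall b, I b.

(** Zero as soon as [t * t] is a combination of [t] and 1 with central
    coefficients. *)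
Definition quad_defect (t u v w : B) : B :=
  lie_bracket (t * t) u * v * lie_bracket t w -
  lie_bracket t u * v * lie_bracket (t * t) w.

Definition quad_defects : set B :=
  [set c | exists t u v w, c = quad_defect t u v w].

Definition commutators : set B := [set c | exists u v, c = lie_bracket u v].

Lemma two_sidedN I x : two_sided I -> I x -> I (- x).
Proof. by case=> _ _ hl _ /(hl (-1)); rewrite mulN1r. Qed.

Lemma generates_commutators : generates quad_defects -> generates commutators.
Proof.
move=> gen I iI sI b; apply: gen => // _ [t [u [v [w ->]]]].
have com x y : I (lie_bracket x y) by apply: sI; exists x, y.
case: (iI) => _ hD hl hr; apply: (hD); last apply: two_sidedN => //.
- exact/hl/com.
- exact/hl/com.
Qed.

(** The defect is E(t^2) for E(s) = [s,u] v [t,w] - [t,u] v [s,w], and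
    E(1) = E(t) = 0.  Expanding E as a sum of maps s |-> a s b and substituting
    z a for z before multiplying by b on the right keeps only the term in t^2. *)
Lemma right_extract (t U V W : B) (F : B -> B) :
  (forall z, U * z + V * z * t + W * z * t * t = F z) ->
  forall u v w z, W * z * quad_defect t u v w =
    F z * u * v * lie_bracket t w - F (z * u) * v * lie_bracket t w
    - F (z * (lie_bracket t u * v)) * w
    + F (z * (lie_bracket t u * v) * w).
Proof. by move=> FE u v w z; rewrite -!FE /quad_defect; nc_ring. Qed.

Lemma left_extract (t U V W : B) (F : B -> B) :
  (forall z, z * U + t * z * V + t * t * z * W = F z) ->
  forall u v w z, quad_defect t u v w * z * W =
    F (u * v * lie_bracket t w * z) - u * F (v * lie_bracket t w * z)
    - lie_bracket t u * v * F (w * z)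
    + lie_bracket t u * v * w * F z.
Proof. by move=> FE u v w z; rewrite -!FE /quad_defect; nc_ring. Qed.

(** Stability on the right uses the Leibniz rule for the bracket with [n]. *)
Lemma commutator_annihilator_two_sided (n : B) :
  two_sided [set c | forall z, c * (lie_bracket z n) = 0].
Proof.
split=> /= [z|x y hx hy z|a x hx z|a x hx z].
- by rewrite mul0r.
- by rewrite mulrDl hx hy addr0.
- by rewrite -mulrA hx mulr0.
apply: (@eq_of_diff _ _ _ (x * lie_bracket (a * z) n - x * lie_bracket a n * z) 0).
  by rewrite !hx mul0r subr0.
nc_ring.
Qed.

Lemma central_annihilator_two_sided (n : B) : ring_center B n ->
  two_sided [set c | n * c = 0].
Proof.
move=> nc; split=> /= [|x y hx hy|a x hx|a x hx].
- by rewrite mulr0.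
- by rewrite mulrDr hx hy addr0.
- by rewrite mulrA nc -mulrA hx mulr0.
by rewrite mulrA hx mul0r.
Qed.

Lemma left_annihilator_two_sided (n : B) :
  two_sided [set c | forall z, c * z * n = 0].
Proof.
split=> /= [z|x y hx hy z|a x hx z|a x hx z].
- by rewrite !mul0r.
- by rewrite !mulrDl hx hy addr0.
- by rewrite -!mulrA (mulrA x) hx mulr0.
by rewrite -(mulrA x) hx.
Qed.

End Ideals.

(** * Functional identities along a surjection *)

(** The variables x of the identities range over [A] and enter through [f x]; the
    section [s] makes it possible to substitute t (f x) or (f x) t for f x.  The
    coefficient functions are arbitrary. *)
Section FunctionalIdentities.
Variables (A B : pzRingType) (f : A -> B) (s : B -> A).
Hypothesis fK : cancel s f.
Hypothesis gen : generates (@quad_defects B).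

Let genC := generates_commutators gen.

(** Substituting t x for x and subtracting t times the identity removes the term
    that starts with f x; doing the same for y leaves an identity in z alone, to
    which [left_extract] applies. *)
Lemma left_identity3 (P P' : A -> B -> B) (N M : A -> A -> B) :
  (forall x y z, f x * P y z + f y * P' x z + z * N x y = M x y * z) ->
  forall t u v w x y, exists m, (forall z, quad_defect t u v w * z * N x y = m * z)
     /\ ((forall a b, M a b = 0) -> m = 0).
Proof.
move=> E t u v w x y.
pose x' := s (t * f x); pose y' := s (t * f y).
pose m := M x' y' - t * M x y' - t * M x' y + t * t * M x y.
have FE z : z * N x' y' + t * z * (- N x y' - N x' y) + t * t * z * N x y = m * z.
  have e1 := E x' y' z; have e2 := congr1 (fun c => t * c) (E x y' z).
  have e3 := congr1 (fun c => t * c) (E x' y z).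
  have e4 := congr1 (fun c => t * t * c) (E x y z).
  rewrite /= /x' /y' !fK -/x' -/y' in e1 e2 e3 e4.
  rewrite /m; apply: (eq_of_diff (congr2 (fun c d => c + d)
    (congr2 (fun c d => c - d) e1 e2) (congr2 (fun c d => c - d) e4 e3))).
  nc_ring.
exists (m * (u * v * lie_bracket t w) - u * m * (v * lie_bracket t w)
    - lie_bracket t u * v * m * w + lie_bracket t u * v * w * m); split.
  by move=> z; rewrite (left_extract FE); nc_ring.
by move=> M0; rewrite /m !M0; nc_ring.
Qed.

(** By [left_identity3], q z N = m z for a defect q; z = 1 gives m = q N, so q kills
    the commutators of N. *)
Lemma left_identity3_central (P P' : A -> B -> B) (N M : A -> A -> B) :
  (forall x y z, f x * P y z + f y * P' x z + z * N x y = M x y * z) ->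
  forall x y, ring_center B (N x y).
Proof.
move=> E x y z.
have := gen (commutator_annihilator_two_sided (N x y)) _ 1 => /(_ _ z).
rewrite mul1r /lie_bracket => h; apply/esym/eqP; rewrite -subr_eq0; apply/eqP.
apply: h => _ [t [u [v [w ->]]]] /= {}z.
have [m [mE _]] := left_identity3 E t u v w x y.
have := mE 1; rewrite !mulr1 => m1.
by rewrite /lie_bracket mulrBr !mulrA mE -m1 subrr.
Qed.

Lemma left_identity3_eq0 (P P' : A -> B -> B) (N : A -> A -> B) :
  (forall x y z, f x * P y z + f y * P' x z + z * N x y = 0) ->
  forall x y, N x y = 0.
Proof.
move=> E x y.
have E' a b z : f a * P b z + f b * P' a z + z * N a b = 0 * z by rewrite E mul0r.
have := gen (left_annihilator_two_sided (N x y)) _ 1 1; rewrite !mul1r; apply.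
move=> _ [t [u [v [w ->]]]] z /=.
have [m [mE m0]] := left_identity3 E' t u v w x y.
by rewrite mE m0 // mul0r.
Qed.

(** * Commuting traces of symmetric maps *)
Section CommutingTrace.
Variable Q : A -> A -> B.
Hypothesis Qsym : forall x y, Q x y = Q y x.
Hypothesis Qcyc : forall x y z, lie_bracket (Q x y) (f z) +
  lie_bracket (Q y z) (f x) + lie_bracket (Q z x) (f y) = 0.

(** Three-variable form of the elimination: the substitutions x t for x and y t for
    y remove the terms that end in f x and f y; besides terms that start with f x,
    f y or z there remain U z + V z t + Q(x,y) z t^2, and [right_extract] isolates
    Q(x,y) z times a defect. *)
Lemma commuting_one_sided : exists (P : A -> B -> B) (N : A -> A -> B),
  forall x y z, Q x y * z = f x * P y z + f y * P x z + z * N x y.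
Proof.
pose I : set B := [set c | exists (P : A -> B -> B) (N : A -> A -> B),
  forall x y z, Q x y * z * c = f x * P y z + f y * P x z + z * N x y].
have iI : two_sided I.
  split=> [|c d [P [N E]] [P' [N' E']]|a c [P [N E]]|a c [P [N E]]].
  - by exists (fun _ _ => 0), (fun _ _ => 0) => x y z; nc_ring.
  - exists (fun y z => P y z + P' y z), (fun x y => N x y + N' x y) => x y z.
    by rewrite mulrDr E E'; nc_ring.
  - exists (fun y z => P y (z * a)), (fun x y => a * N x y) => x y z.
    by rewrite [LHS]mulrA -[X in X * c]mulrA E; nc_ring.
  exists (fun y z => P y z * a), (fun x y => N x y * a) => x y z.
  by rewrite [LHS]mulrA E; nc_ring.
have [|P [N E]] := gen iI _ 1; last first.
  by exists P, N => x y z; rewrite -E mulr1.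
move=> _ [t [u [v [w ->]]]].
pose m y := s (f y * t).
have fm y : f (m y) = f y * t by rewrite fK.
(* [p] and [n] collect the terms that start with f x or f y, and with z. *)
pose p y z := lie_bracket (Q y (s z)) t * t - lie_bracket (Q (m y) (s z)) t.
pose n x y := Q (m x) (m y) - Q (m x) y * t - Q x (m y) * t + Q x y * t * t.
pose k := lie_bracket t w; pose l := lie_bracket t u * v.
exists (fun y z => p y z * u * v * k - p y (z * u) * v * k - p y (z * l) * w
                   + p y (z * l * w)).
exists (fun x y => n x y * u * v * k - u * n x y * v * k - l * n x y * w
                   + l * w * n x y) => x y z.
have FE c : Q (m x) (m y) * c + (- Q (m x) y - Q x (m y)) * c * t
    + Q x y * c * t * t = f x * p y c + f y * p x c + c * n x y.
  have e1 := Qcyc (m x) (m y) (s c); have e2 := congr1 (fun d => d * t) (Qcyc x (m y) (s c)).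
  have e3 := congr1 (fun d => d * t) (Qcyc (m x) y (s c)).
  have e4 := congr1 (fun d => d * t * t) (Qcyc x y (s c)).
  rewrite /= ![Q (s c) _]Qsym !fm !fK in e1 e2 e3 e4.
  apply: (eq_of_diff (congr2 (fun c d => c + d)
    (congr2 (fun c d => c - d) e1 e2) (congr2 (fun c d => c - d) e4 e3))).
  rewrite /p /n; nc_ring.
rewrite (right_extract FE) -/k -/l; nc_ring.
Qed.

(** Comparing the one-sided form at z with its value at 1 multiplied by z leaves a
    left identity whose third coefficient must be central. *)
Lemma commuting_trace_linear : exists (p : A -> B) (N : A -> A -> B),
  (forall x y, ring_center B (N x y)) /\
  forall x y, Q x y = f x * p y + f y * p x + N x y.
Proof.
have [P [N E]] := commuting_one_sided.
have E1 x y : Q x y = f x * P y 1 + f y * P x 1 + N x y.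
  by rewrite -[LHS]mulr1 E mul1r.
exists (fun y => P y 1), N; split=> //.
pose D y z := P y z - P y 1 * z.
apply: (@left_identity3_central D D N N) => x y z.
by apply: (eq_of_diff (congr2 (fun c d => c - d)
  (esym (E x y z)) (esym (congr1 (fun d => d * z) (E1 x y))))); rewrite /D; nc_ring.
Qed.

(** The two-variable analogue, in which commutators play the role of the defects:
    substituting y t for y isolates p(y) z t, and comparing the result at z w with
    the result at z multiplied by w gives p(y) z [t,w]. *)
Lemma commuting_additive_form (p : A -> B) :
  (forall y z, lie_bracket (p y) (f z) = lie_bracket (f y) (p z)) ->
  exists (l : B) (mu : A -> B), [/\ ring_center B l,
    forall y, ring_center B (mu y) & forall y, p y = f y * l + mu y].
Proof.
move=> E.
pose I : set B := [set c | exists (F : B -> B) (G : A -> B),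
  forall y z, p y * z * c = f y * F z + z * G y].
have iI : two_sided I.
  split=> [|c d [F [G H]] [F' [G' H']]|a c [F [G H]]|a c [F [G H]]].
  - by exists (fun _ => 0), (fun _ => 0) => y z; nc_ring.
  - exists (fun z => F z + F' z), (fun y => G y + G' y) => y z.
    by rewrite mulrDr H H'; nc_ring.
  - exists (fun z => F (z * a)), (fun y => a * G y) => y z.
    by rewrite [LHS]mulrA -[X in X * c]mulrA H; nc_ring.
  exists (fun z => F z * a), (fun y => G y * a) => y z.
  by rewrite [LHS]mulrA H; nc_ring.
have [|F [G {}H]] := genC iI _ 1.
  move=> _ [t [w ->]].
  pose n y := p (s (f y * t)) - p y * t.
  pose F z := lie_bracket t (p (s z)).
  exists (fun z => F (z * w) - F z * w), (fun y => w * n y - n y * w) => y z.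
  have FE c : p (s (f y * t)) * c - p y * c * t = f y * F c + c * n y.
    have e1 := E (s (f y * t)) (s c); have e2 := congr1 (fun d => d * t) (E y (s c)).
    rewrite /= !fK in e1 e2.
    apply: (eq_of_diff (congr2 (fun c d => c - d) e1 e2)).
    rewrite /F /n; nc_ring.
  apply: (eq_of_diff (congr2 (fun c d => c - d) (FE (z * w)) (congr1 (fun d => d * w) (FE z)))).
  nc_ring.
have {}H y z : p y * z = f y * F z + z * G y by rewrite -H mulr1.
have p1 y : p y = f y * F 1 + G y by have := H y 1; rewrite mulr1 mul1r.
have Gc y : ring_center B (G y).
  move=> z; apply/esym/eqP; rewrite -subr_eq0; apply/eqP.
  have := genC (commutator_annihilator_two_sided (G y)) _ 1 => /(_ _ z).
  rewrite mul1r; apply => _ [b [t ->]] /= {}z.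
  pose y' := s (t * f y).
  pose M := G y' - t * G y.
  have FE c : c * G y' - t * c * G y = M * c.
    have e1 := H y' c; have e2 := congr1 (fun d => t * d) (H y c).
    have e3 := congr1 (fun d => d * c) (p1 y').
    have e4 := congr1 (fun d => t * d * c) (p1 y).
    rewrite /= /y' !fK -/y' in e1 e2 e3 e4.
    apply: (eq_of_diff (congr2 (fun c d => c + d)
      (congr2 (fun c d => c - d) e2 e1) (congr2 (fun c d => c - d) e3 e4))).
    by rewrite /M; nc_ring.
  have e c : lie_bracket b t * c * G y = (M * b - b * M) * c.
    apply: (eq_of_diff (congr2 (fun c d => c - d) (FE (b * c)) (congr1 (fun d => b * d) (FE c)))).
    nc_ring.
  apply: (@eq_of_diff _ _ _ (lie_bracket b t * z * G y - lie_bracket b t * 1 * G y * z) 0).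
    by rewrite !e; nc_ring.
  nc_ring.
exists (F 1), G; split=> // z.
have := E (s 1) (s z); rewrite !p1 !fK => e.
apply: (eq_of_diff e).
nc_ring (tt, Gc (s 1), Gc (s z)).
Qed.

(** Inserting the form Q(x,y) = f x p(y) + f y p(x) + N(x,y) in the cyclic identity
    and sorting by the first factor shows that [p(y), f z] + [p(z), f y] = 0. *)
Lemma commuting_trace_standard : exists (l : B) (mu : A -> B) (N : A -> A -> B),
  [/\ ring_center B l, forall x, ring_center B (mu x),
      forall x y, ring_center B (N x y) &
      forall x y, Q x y = l * (f x * f y + f y * f x)
                          + mu x * f y + mu y * f x + N x y].
Proof.
have [p [N [Nc E]]] := commuting_trace_linear.
pose K y z := lie_bracket (p y) (f z) + lie_bracket (p z) (f y).
have K0 x y z : f x * K y z + f y * K x z + f z * K x y = 0.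
  rewrite -(Qcyc x y z) !E /K.
  nc_ring (tt, Nc x y, Nc y z, Nc z x).
have pE y z : lie_bracket (p y) (f z) = lie_bracket (f y) (p z).
  have h : K y z = 0.
    apply: (@left_identity3_eq0 (fun y z => K y (s z)) (fun y z => K y (s z)) K).
    by move=> a b c; rewrite -{3}(fK c).
  by apply: (eq_of_diff h); rewrite /K; nc_ring.
have [l [mu [lc muc pl]]] := commuting_additive_form pE.
exists l, mu, N; split=> // x y; rewrite E !pl.
nc_ring (tt, lc, muc x, muc y).
Qed.

End CommutingTrace.

End FunctionalIdentities.

(** * Surjective Lie homomorphisms of rings *)
Section Center.
Variable B : pzRingType.
Lemma ring_center1 : ring_center B 1.
Proof. by move=> x; rewrite mul1r mulr1. Qed.
Lemma ring_centerD x y : ring_center B x -> ring_center B y -> ring_center B (x + y).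
Proof. by move=> cx cy z; rewrite mulrDl mulrDr cx cy. Qed.
Lemma ring_centerN x : ring_center B x -> ring_center B (- x).
Proof. by move=> cx z; rewrite mulNr mulrN cx. Qed.
Lemma ring_centerM x y : ring_center B x -> ring_center B y -> ring_center B (x * y).
Proof. by move=> cx cy z; rewrite -mulrA cy mulrA cx mulrA. Qed.
End Center.

Lemma additive_of (A B : pzRingType) (g : A -> B) :
  (forall x y, g (x + y) = g x + g y) ->
  exists T : {additive A -> B}, forall x, T x = g x.
Proof.
move=> gD.
have g0 : g 0 = 0 by apply: (addrI (g 0)); rewrite -gD !addr0.
have gB : zmod_morphism g.
  move=> x y; apply/eqP; rewrite eq_sym subr_eq -gD subrK //.
pose m := GRing.isZmodMorphism.Build A B g gB.
pose T : {additive A -> B} := HB.pack g m.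
by exists T.
Qed.

(** The hypothesis [semiprime] excludes nonzero one-sided ideals all of whose
    elements have square zero; for a semisimple ring it holds by
    [semisimple_semiprime]. *)
Section LieHomomorphisms.
Variables A B : pzRingType.
Hypothesis gen : generates (@quad_defects B).
Hypothesis semiprime : forall n : B, (forall b, (b * n) * (b * n) = 0) -> n = 0.
Variable half : B.
Hypothesis halfc : ring_center B half.
Hypothesis half2 : half + half = 1.
Hypothesis torsion3 : forall x : B, x + x + x = 0 -> x = 0.

Variable f : {additive A -> B}.
Hypothesis f_lie : lie_homomorphism f.
Hypothesis f_surj : set_surj [set: A] [set: B] f.

Let genC := generates_commutators gen.

Lemma has_section : exists s : B -> A, cancel s f.
Proof.
have h b : exists a, f a = b by have [a _ <-] := f_surj (I : [set: B] b); exists a.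
by have [s sE] := choice h; exists s.
Qed.

Lemma central_eq0_of_commutators (z : B) : ring_center B z ->
  (forall u v, z * lie_bracket u v = 0) -> z = 0.
Proof.
move=> zc h; have := genC (central_annihilator_two_sided zc) _ 1; rewrite /= mulr1.
by apply => _ [u [v ->]]; exact: h.
Qed.

Lemma central_square_eq0 (z : B) : ring_center B z -> z * z = 0 -> z = 0.
Proof.
move=> zc z2; apply: semiprime => b.
by rewrite -mulrA (mulrA z) zc -(mulrA b) z2 !mulr0.
Qed.

Lemma eq0_of_double (x : B) : x + x = 0 -> x = 0.
Proof. by move=> x2; rewrite -[x]mul1r -half2 mulrDl -mulrDr x2 mulr0. Qed.

(** Bracketing with w gives g(z) [x,w] + h(x) [z,w] = 0; for w = z this is
    g(z) [x,z] = 0, and then g(z)^2 [x,w] = 0. *)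
Lemma central_combination_eq0 (g h : A -> B) :
  (forall x, ring_center B (g x)) -> (forall x, ring_center B (h x)) ->
  (forall x z, ring_center B (g z * f x + h x * f z)) -> forall z, g z = 0.
Proof.
move=> gc hc E z; have [s fK] := has_section.
have e b w : g z * lie_bracket b w + h (s b) * lie_bracket (f z) w = 0.
  apply: (eq_of_diff (E (s b) z w)); rewrite fK.
  nc_ring (tt, gc z, hc (s b)).
have e0 b : g z * lie_bracket b (f z) = 0.
  by have := e b (f z); rewrite [X in _ + _ * X]/lie_bracket subrr mulr0 addr0.
apply: central_square_eq0 => //; apply: central_eq0_of_commutators; first exact: ring_centerM.
move=> u v.
apply: (@eq_of_diff _ _ _ (g z * (g z * lie_bracket u v + h (s u) * lie_bracket (f z) v)
  + h (s u) * (g z * lie_bracket v (f z))) 0).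
  by rewrite e e0; nc_ring.
nc_ring (tt, gc z, hc (s u)).
Qed.

(** With the term r t^3 x moved to the other side, the hypothesis is an identity in
    x with left coefficients 1, t, t^2, and t^2 comes with t^2 x (3 r t).  Hence
    q x (3 r t) = m x for each defect q of t and some m independent of x, so that
    3 r q [x,t] = 0.  Since q is a combination of products that contain brackets
    with t, every element of the left ideal generated by r q has square zero. *)
Lemma triple_commutator_eq0 (r : B) (k : B -> B) : ring_center B r ->
  (forall t, ring_center B (k t)) ->
  (forall t x, r * lie_bracket (lie_bracket (lie_bracket x t) t) t
               + k t * lie_bracket x t = 0) -> r = 0.
Proof.
move=> rc kc E.
have ann t u v w b : r * quad_defect t u v w * lie_bracket b t = 0.
  have FE z : z * (r * t * t * t + k t * t) + t * z * (- (r + r + r) * t * t - k t)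
      + t * t * z * ((r + r + r) * t) = r * t * t * t * z.
    by apply: (eq_of_diff (E t z)); nc_ring (tt, rc, kc t).
  apply: torsion3.
  have e z := left_extract FE u v w z.
  apply: (@eq_of_diff _ _ _ (quad_defect t u v w * b * ((r + r + r) * t) -
   quad_defect t u v w * 1 * ((r + r + r) * t) * b) 0).
    by rewrite !e; nc_ring (tt, rc).
  nc_ring (tt, rc, kc t).
apply: (@eq_of_diff _ _ _ (r * 1) 0); last by nc_ring.
apply: (gen (central_annihilator_two_sided rc)) => _ [t [u [v [w ->]]]] /=.
set q := quad_defect t u v w.
have ann2 b c : r * q * c * lie_bracket b t = 0.
  apply: (@eq_of_diff _ _ _ (r * q * lie_bracket (c * b) t - r * q * lie_bracket c t * b) 0).
    by rewrite !ann; nc_ring.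
  nc_ring.
apply: semiprime => b.
have -> : b * (r * q) * (b * (r * q)) =
    b * r * (- (r * q * (b * t) * lie_bracket u t)
             - (r * q * b * lie_bracket u t) * t) * v * lie_bracket t w
    + b * r * (r * q * b * lie_bracket u t) * v * lie_bracket (t * t) w.
  move: {-2}q => p; rewrite /q /quad_defect; nc_ring (tt, rc).
by rewrite !ann2; nc_ring.
Qed.

(** With l, mu, N as in the standard form, applying [f] to
    x o (y o z) - (x o y) o z = [[x,z],y] shows that
    (l^2 - 1) [[x,z],y] + k(y,z) x - k(x,y) z is central, where
    k(y,z) = 2 l N(y,z) + mu(y o z) - mu(y) mu(z).  Then l^2 = 1, and k = 0 is
    exactly what is needed to complete the square. *)
Lemma lie_homomorphism_jordan_form :
  exists (l : B) (mu : A -> B),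
  [/\ ring_center B l, l * l = 1, forall x, ring_center B (mu x),
    forall x y, mu (x + y) = mu x + mu y &
    forall x y, f (x * y + y * x) + half * l * mu (x * y + y * x) =
       l * ((f x + half * l * mu x) * (f y + half * l * mu y) +
            (f y + half * l * mu y) * (f x + half * l * mu x))].
Proof.
have [s fK] := has_section.
pose J x y : A := x * y + y * x.
have JC x y : J x y = J y x by rewrite /J addrC.
have Jcyc x y z : lie_bracket (f (J x y)) (f z) + lie_bracket (f (J y z)) (f x) +
    lie_bracket (f (J z x)) (f y) = 0.
  by rewrite -!f_lie -!raddfD -(raddf0 f) /J; congr (f _); nc_ring.
have [l [mu [N [lc muc Nc E]]]] := @commuting_trace_standard _ _ _ _ fK gen
  (fun x y => f (J x y)) (fun x y => congr1 f (JC x y)) Jcyc.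
have muD x y : mu (x + y) = mu x + mu y.
  pose d := mu (x + y) - mu x - mu y.
  have dc : ring_center B d by do 2?[apply: ring_centerD => //; try exact: ring_centerN].
  apply: (@eq_of_diff _ _ _ d 0); last by rewrite /d; nc_ring.
  apply: central_eq0_of_commutators => // u v.
  have e : J (s u) (x + y) = J (s u) x + J (s u) y by rewrite /J; nc_ring.
  have {}e := congr1 f e; rewrite E [in RHS]raddfD !E raddfD !fK in e.
  have {}e := congr1 (fun c => lie_bracket c v) e; rewrite /= in e.
  apply: (eq_of_diff e); rewrite /d.
  nc_ring (tt, lc, muc (x + y), muc x, muc y, muc (s u), Nc (s u) (x + y),
           Nc (s u) x, Nc (s u) y).
pose k y z := l * N y z + l * N y z + mu (J y z) - mu y * mu z.
have kc y z : ring_center B (k y z).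
  by rewrite /k; do ?[apply: ring_centerD => //; try apply: ring_centerN]; exact: ring_centerM.
have kE x y z w : (l * l - 1) *
     lie_bracket (lie_bracket (lie_bracket (f x) (f z)) (f y)) w
   + k y z * lie_bracket (f x) w - k x y * lie_bracket (f z) w = 0.
  have e : J x (J y z) - J (J x y) z = lie_bracket (lie_bracket x z) y.
    by rewrite /J; nc_ring.
  have {}e := congr1 (fun c => lie_bracket (f c) w) e.
  rewrite /= !f_lie raddfB !E in e.
  apply: (eq_of_diff e); rewrite /k.
  nc_ring (tt, lc, muc x, muc y, muc z, Nc x y, Nc y z, muc (J x y), muc (J y z),
    Nc x (J y z), Nc (J x y) z).
have l2 : l * l = 1.
  apply/eqP; rewrite -subr_eq0; apply/eqP.
  have rc : ring_center B (l * l - 1).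
    by apply: ring_centerD; [exact: ring_centerM|exact/ring_centerN/ring_center1].
  apply: (@triple_commutator_eq0 _ (fun t => k (s t) (s t))) => // t x.
  have := kE (s x) (s t) (s t) t; rewrite !fK => e.
  by apply: (eq_of_diff e); nc_ring (tt, rc, kc (s t) (s t), kc (s x) (s t)).
have k0 y z : k y z = 0.
  apply: (@central_combination_eq0 (k y) (fun x => - k x y)) => //.
    by move=> x; exact: ring_centerN.
  move=> x {}z w; have := kE x y z w; rewrite l2 => e.
  by apply: (eq_of_diff e); nc_ring (tt, kc y z, kc x y).
exists l, mu; split=> // x y; rewrite -/(J x y) E.
have muE := k0 x y; rewrite /k in muE.
have ll : 1 - (half + half) * l * l = 0 by rewrite half2 mul1r l2 subrr.
apply: (@eq_of_diff _ _ _
  (half * l * (l * N x y + l * N x y + mu (J x y) - mu x * mu y)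
   + (1 - (half + half) * l * l)
     * (mu x * f y + mu y * f x + N x y + half * l * mu x * mu y)) 0).
  by rewrite muE ll; nc_ring.
nc_ring (tt, halfc, lc, muc x, muc y, muc (J x y), Nc x y).
Qed.

(** The c such that z c is a value of Theta for every central z form an ideal: any d
    is a value of Theta up to a central element, and a product of values is again
    a value as soon as one factor lies in e B, where Theta is multiplicative, or
    in (1 - e) B, where it is minus antimultiplicative.  This ideal contains the
    commutators. *)
Lemma surjective_of_commutators (Theta : {additive A -> B}) :
  direct_sum_hom_neg_antihom Theta ->
  (forall x, ring_center B (f x - Theta x)) ->
  (forall u v, exists x, Theta x = lie_bracket u v) ->
  set_surj [set: A] [set: B] Theta.
Proof.
move=> [e [ec e2 E]] zc C.
pose T b := exists x, Theta x = b.
have TD b c : T b -> T c -> T (b + c).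
  by move=> [x <-] [y <-]; exists (x + y); rewrite raddfD.
have E1 x y : e * Theta (x * y) - e * Theta x * Theta y = 0.
  by have [-> _] := E x y; rewrite subrr.
have E2 x y : (1 - e) * Theta (x * y) + (1 - e) * Theta y * Theta x = 0.
  by have [_ ->] := E x y; rewrite addNr.
have fc : ring_center B (1 - e).
  by apply: ring_centerD; [exact: ring_center1|exact: ring_centerN].
have kill a x y : ring_center B a -> a * x = 0 \/ a * y = 0 ->
    a * x * y = 0 /\ a * y * x = 0.
  move=> ac [] h; rewrite h mul0r; split=> //.
    by rewrite ac -mulrA h mulr0.
  by rewrite ac -mulrA h mulr0.
have ThetaM x y : (1 - e) * Theta x = 0 \/ (1 - e) * Theta y = 0 ->
    Theta (x * y) = Theta x * Theta y.
  move=> /(kill _ _ _ fc)[k1 k2].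
  apply: (@eq_of_diff _ _ _ ((e * Theta (x * y) - e * Theta x * Theta y)
   + ((1 - e) * Theta (x * y) + (1 - e) * Theta y * Theta x)
   - (1 - e) * Theta x * Theta y - (1 - e) * Theta y * Theta x) 0).
    by rewrite E1 E2 k1 k2; nc_ring.
  nc_ring (tt, ec).
have ThetaM' x y : e * Theta x = 0 \/ e * Theta y = 0 ->
    - Theta (x * y) = Theta y * Theta x.
  move=> /(kill _ _ _ ec)[k1 k2].
  apply: (@eq_of_diff _ _ _ (- (e * Theta (x * y) - e * Theta x * Theta y)
   - ((1 - e) * Theta (x * y) + (1 - e) * Theta y * Theta x)
   - e * Theta x * Theta y - e * Theta y * Theta x) 0).
    by rewrite E1 E2 k1 k2; nc_ring.
  nc_ring (tt, ec).
pose I : set B := [set c | forall z, ring_center B z -> T (z * c)].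
have I_mul c d : I c -> I (d * c) /\ I (c * d).
  move=> Ic; have [y _ <-] := f_surj (Logic.I : [set: B] d).
  pose zy := f y - Theta y; have zyc : ring_center B zy := zc y.
  suff H z : ring_center B z -> T (z * (f y * c)) /\ T (z * (c * f y)).
    by split=> z /H[].
  move=> z_c.
  have [x1 x1E] : T (z * e * c) by apply/Ic/ring_centerM.
  have [x2 x2E] : T (z * (1 - e) * c) by apply/Ic/ring_centerM.
  have T0 : T (z * zy * c) by apply/Ic/ring_centerM.
  have h1 : (1 - e) * Theta x1 = 0.
    rewrite x1E; apply: (@eq_of_diff _ _ _ (z * (e - e * e) * c) 0).
      by rewrite e2; nc_ring.
    nc_ring (tt, ec, z_c).
  have h2 : e * Theta x2 = 0.
    rewrite x2E; apply: (@eq_of_diff _ _ _ (z * (e - e * e) * c) 0).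
      by rewrite e2; nc_ring.
    nc_ring (tt, ec, z_c).
  split.
    have -> : z * (f y * c) = z * zy * c + (Theta y * Theta x1 + Theta y * Theta x2).
      by rewrite x1E x2E /zy; nc_ring (tt, ec, z_c).
    apply: (TD) => //; apply: (TD).
      by rewrite -ThetaM; [exists (y * x1)|right].
    by rewrite -ThetaM'; [exists (- (x2 * y)); rewrite raddfN|left].
  have -> : z * (c * f y) = z * zy * c + (Theta x1 * Theta y + Theta x2 * Theta y).
    rewrite x1E x2E; apply: (@eq_of_diff _ _ _ (z * c * zy) (z * zy * c)).
      by rewrite -mulrA -zyc mulrA.
    by rewrite /zy; nc_ring (tt, ec, z_c).
  apply: (TD) => //; apply: (TD).
    by rewrite -ThetaM; [exists (x1 * y)|left].
  by rewrite -ThetaM'; [exists (- (y * x2)); rewrite raddfN|right].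
have iI : two_sided I.
  split=> [z _|c d Ic Id z z_c|d c Ic|d c Ic].
  - by exists 0; rewrite mulr0 raddf0.
  - by rewrite mulrDr; exact: TD _ _ (Ic z z_c) (Id z z_c).
  - by have [] := I_mul c d Ic.
  - by have [] := I_mul c d Ic.
move=> b _.
have Ib : I b.
  apply: (genC iI) => _ [u [v ->]] z z_c; have [x xE] := C (z * u) v.
  by exists x; rewrite xE; nc_ring (tt, z_c).
have [x xE] := Ib 1 (@ring_center1 B).
by exists x => //; rewrite xE mul1r.
Qed.

(** That Theta preserves brackets exactly, and not only up to the central element
    m [x,y], comes from [x, z o w] = z o [x,w] + w o [x,z]: applying Theta to it
    shows that 2 l (m [x,w] Theta z + m [x,z] Theta w) is central. *)
Lemma lie_homomorphism_decomposition :
  exists Theta zeta : {additive A -> B},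
    [/\ forall x, f x = Theta x + zeta x,
        set_surj [set: A] [set: B] Theta,
        direct_sum_hom_neg_antihom Theta,
        forall x, ring_center B (zeta x) &
        vanishes_on_commutators zeta].
Proof.
have [l [mu [lc l2 muc muD E]]] :=
  lie_homomorphism_jordan_form.
have mcc x : ring_center B (half * l * mu x) by do ?apply: ring_centerM.
have [|m mE] := @additive_of A B (fun x => half * l * mu x).
  by move=> x y; rewrite muD mulrDr.
have {}mcc x : ring_center B (m x) by rewrite mE.
have [|Theta TE] := @additive_of A B (fun x => f x + m x).
  by move=> x y; rewrite !raddfD addrACA.
have [|zeta zE] := @additive_of A B (fun x => - m x).
  by move=> x y; rewrite raddfD opprD.
have TJ x y : Theta (x * y + y * x) = l * (Theta x * Theta y + Theta y * Theta x).
  by rewrite !TE !mE E.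
have TL x y : Theta (lie_bracket x y) = lie_bracket (Theta x) (Theta y) + m (lie_bracket x y).
  rewrite !TE f_lie; nc_ring (tt, mcc x, mcc y).
have fE x : f x = Theta x - m x by rewrite TE addrK.
have m0 x y : m (lie_bracket x y) = 0 :> B.
  pose g z := l * (m (lie_bracket x z) + m (lie_bracket x z)).
  have gc z : ring_center B (g z).
    by apply: ring_centerM => //; apply: ring_centerD.
  apply: eq0_of_double.
  rewrite -[LHS]mul1r -l2 -mulrA -/(g y).
  rewrite (@central_combination_eq0 g g) ?mulr0 // => z w.
  have e : lie_bracket x (z * w + w * z) = (z * lie_bracket x w + lie_bracket x w * z)
      + (w * lie_bracket x z + lie_bracket x z * w) by nc_ring.
  have {}e := congr1 Theta e; rewrite TL [in RHS]raddfD !TJ !TL in e.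
  set c := m (lie_bracket x (_ + _)) in e.
  have -> : g w * f z + g z * f w = c - g w * m z - g z * m w.
    rewrite !fE; apply: (eq_of_diff (esym e)); rewrite /g.
    set a := m (lie_bracket x z); set b := m (lie_bracket x w).
    have ac : ring_center B a := mcc _; have bc : ring_center B b := mcc _.
    nc_ring (tt, lc, ac, bc, mcc z, mcc w).
  by do 2?[apply: ring_centerD; last exact/ring_centerN/ring_centerM]; exact: mcc.
have dsT : direct_sum_hom_neg_antihom Theta.
  exists (half * (1 + l)); split.
  - by apply: ring_centerM => //; apply: ring_centerD => //; exact: ring_center1.
  - apply: (@eq_of_diff _ _ _ (half * half * (l * l - 1) + half * (1 + l) * (half + half - 1)) 0).
      by rewrite l2 half2 !subrr; nc_ring.
    nc_ring (tt, lc, halfc).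
  move=> x y.
  have J := TJ x y; have L := TL x y; rewrite m0 addr0 in L.
  have S : Theta (x * y) + Theta (x * y) = l * (Theta x * Theta y + Theta y * Theta x)
      + lie_bracket (Theta x) (Theta y).
    by rewrite -J -L -raddfD -raddfD; congr (Theta _); nc_ring.
  have Sz : Theta (x * y) + Theta (x * y) - (l * (Theta x * Theta y + Theta y * Theta x)
      + lie_bracket (Theta x) (Theta y)) = 0 by rewrite S subrr.
  have hz : 1 - half - half = 0 by rewrite -addrA -opprD half2 subrr.
  have lz : l * l - 1 = 0 by rewrite l2 subrr.
  move: Sz; set X := Theta (x * y); set a := Theta x; set b := Theta y => Sz.
  split.
    apply: (@eq_of_diff _ _ _ (half * (1 + l) * half * (X + X - (l * (a * b + b * a)
      + lie_bracket a b)) + half * (1 + l) * (1 - half - half) * (X - a * b)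
      + half * half * (l * l - 1) * (a * b + b * a)) 0).
      by rewrite Sz hz lz; nc_ring.
    nc_ring (tt, lc, halfc).
  apply: (@eq_of_diff _ _ _ ((1 - half * (1 + l)) * half * (X + X - (l * (a * b + b * a)
    + lie_bracket a b)) + (1 - half * (1 + l)) * (1 - half - half) * (X + b * a)
    - half * half * (l * l - 1) * (a * b + b * a)
    + (1 - half - half) * half * (1 + l) * (a * b + b * a)) 0).
    by rewrite Sz hz lz; nc_ring.
  nc_ring (tt, lc, halfc).
exists Theta, zeta; split.
- by move=> x; rewrite TE zE addrK.
- apply: surjective_of_commutators => //.
  + by move=> x; rewrite TE opprD addrA subrr sub0r; exact: ring_centerN.
  + move=> u v; have [x _ <-] := f_surj (Logic.I : [set: B] u).
    have [y _ <-] := f_surj (Logic.I : [set: B] v).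
    by exists (lie_bracket x y); rewrite TE m0 addr0 f_lie.
- exact: dsT.
- by move=> x; rewrite zE; apply: ring_centerN.
- by move=> x y; rewrite zE m0 oppr0.
Qed.
End LieHomomorphisms.

(** * Simple algebras in which every element is quadratic *)
Lemma algebra_isomorphic_of (K : pzRingType) (A B : algType K)
    (g : A -> B) (h : B -> A) :
  (forall x y, g (x + y) = g x + g y) -> (forall k x, g (k *: x) = k *: g x) ->
  (forall x y, g (x * y) = g x * g y) -> g 1 = 1 ->
  cancel g h -> cancel h g -> algebra_isomorphic A B.
Proof.
move=> gD gZ gM g1 gK hK.
have gB : zmod_morphism g.
  by move=> x y; apply/eqP; rewrite eq_sym subr_eq -gD subrK.
pose mB := GRing.isZmodMorphism.Build A B g gB.
pose mM := GRing.isMonoidMorphism.Build A B g (conj g1 gM).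
pose mZ := GRing.isScalable.Build K A B *:%R g gZ.
pose G : {lrmorphism A -> B} := HB.pack g mB mM mZ.
by exists G; exists h.
Qed.

Section SimpleQuadratic.
Variables (K : numClosedFieldType) (S : algType K).
Hypothesis simpleS : forall I : set S, two_sided I -> forall x, I x -> x != 0 ->
  forall b, I b.
Hypothesis centralS : forall z : S, ring_center S z -> exists k : K, z = k%:A.
Hypothesis defectS : forall t u v w : S, quad_defect t u v w = 0.

Lemma simple_prime (a b : S) : (forall x, a * x * b = 0) -> a = 0 \/ b = 0.
Proof.
move=> ab; have [->|a0] := eqVneq a 0; [by left|right].
by have := simpleS (left_annihilator_two_sided b) ab a0 1 1; rewrite !mul1r.
Qed.

(** If [t,z0] is not zero, it generates S, and the vanishing of the defects yields d
    with [t^2,x] = [t,x] d for all x.  The Leibniz rule makes d central, say d = l,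
    and then t^2 - l t is central. *)
Lemma quadratic_over_center (t : S) : exists l m : K, t * t = l *: t + m%:A.
Proof.
have [tc|] := pselect (ring_center S t).
  have [k ->] := centralS tc; exists k, 0.
  by rewrite scale0r addr0 -scalerAl mul1r.
move=> /existsNP[z0 /eqP]; rewrite -subr_eq0 -/(lie_bracket t z0) => n0.
pose I : set S := [set c | exists D : S -> S, forall x y,
  lie_bracket (t * t) x * y * c = lie_bracket t x * D y].
have iI : two_sided I.
  split=> [|a b [D HD] [D' HD']|a c [D HD]|a c [D HD]].
  - by exists (fun _ => 0) => x y; rewrite !mulr0.
  - by exists (fun y => D y + D' y) => x y; rewrite !mulrDr HD HD'.
  - by exists (fun y => D (y * a)) => x y; rewrite mulrA -HD !mulrA.
  - by exists (fun y => D y * a) => x y; rewrite mulrA HD mulrA.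
have [|D HD] := simpleS iI _ n0 1.
  exists (fun y => y * lie_bracket (t * t) z0) => x y.
  by apply/eqP; rewrite mulrA -subr_eq0; apply/eqP; exact: defectS.
pose d := D 1.
have {}HD x : lie_bracket (t * t) x = lie_bracket t x * d.
  by rewrite -HD !mulr1.
have dc : ring_center S d.
  move=> y; apply/eqP; rewrite -subr_eq0 -/(lie_bracket d y); apply/eqP.
  have e x : lie_bracket t x * lie_bracket d y = 0.
    apply: (@eq_of_diff _ _ _ 0 (lie_bracket (t * t) (x * y) - lie_bracket (t * t) x * y
       - x * lie_bracket (t * t) y)); first by nc_ring.
    by rewrite !HD; nc_ring.
  have e' x : lie_bracket t z0 * x * lie_bracket d y = 0.
    apply: (@eq_of_diff _ _ _ (lie_bracket t (z0 * x) * lie_bracket d y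
       - z0 * (lie_bracket t x * lie_bracket d y)) 0); last by nc_ring.
    by rewrite !e mulr0 subr0.
  by case: (simple_prime e') => // h; rewrite h eqxx in n0.
have [l dl] := centralS dc.
have [|m mE] := @centralS (t * t - d * t).
  move=> x; apply: (eq_of_diff (HD x)); nc_ring (tt, dc).
exists l, m; rewrite -mE dl -scalerAl mul1r.
by rewrite addrC subrK.
Qed.

Lemma quadratic_split (t : S) : exists a b : K, (t - a%:A) * (t - b%:A) = 0.
Proof.
have [l [m e]] := quadratic_over_center t.
pose r := sqrtC (l ^+ 2 + 4 * m).
have r2 : r ^+ 2 = l ^+ 2 + 4 * m by rewrite sqrtCK.
have [a [b [lE mE]]] : exists a b, l = a + b /\ m + a * b = 0.
  exists ((l + r) / 2), ((l - r) / 2); split; first by field.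
  have -> : (l + r) / 2 * ((l - r) / 2) = (l ^+ 2 - r ^+ 2) / 4 by field.
  by rewrite r2; field.
exists a, b.
have -> : (t - a%:A) * (t - b%:A) = t * t - (a + b) *: t + (a * b)%:A.
  rewrite mulrBl !mulrBr -!scalerAl -!scalerAr !mul1r !mulr1 scalerA scalerDl.
  by rewrite opprB opprD [- _ - _]addrC !addrA [LHS]addrAC.
by rewrite e -lE [l *: t + _]addrC addrK -scalerDl mE scale0r.
Qed.

(** If t has two distinct eigenvalues, a polynomial in t is a nontrivial idempotent.
    Otherwise t differs from a scalar by some n with n^2 = 0, and (n x)^2 is a
    scalar multiple of n x for all x.  Were there no idempotent multiple of any
    n x, all squares (n x)^2 would vanish and linearization would give
    n S n = 0. *)
Lemma nontrivial_idempotent (t : S) : (forall k : K, t != k%:A) ->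
  exists e : S, [/\ e * e = e, e != 0 & e != 1].
Proof.
move=> tns; have [a [b tab]] := quadratic_split t.
have [ab|ab] := eqVneq a b; last first.
  exists ((a - b)^-1 *: (t - b%:A)); split.
  - rewrite -scalerAl -scalerAr; congr (_ *: _).
    have -> : (t - b%:A) * (t - b%:A) = (a - b) *: (t - b%:A).
      transitivity ((t - a%:A) * (t - b%:A) + (a - b)%:A * (t - b%:A)).
        by rewrite -mulrDl scalerBl addrA subrK.
      by rewrite tab add0r -scalerAl mul1r.
    by rewrite scalerA mulVf ?subr_eq0 // scale1r.
  - rewrite scaler_eq0 invr_eq0 !subr_eq0 (negPf ab) /=; exact: tns.
  apply/eqP => /(congr1 (fun x => (a - b) *: x)).
  rewrite scalerA mulfV ?subr_eq0 // scale1r scalerBl => /eqP.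
  by rewrite subr_eq subrK; apply/negP/tns.
pose n := t - a%:A.
have n2 : n * n = 0 by rewrite /n {2}ab.
have n0 : n != 0 by rewrite subr_eq0.
have nM x : n * (n * x) = 0 by rewrite mulrA n2 mul0r.
have sq x : exists l : K, (n * x) * (n * x) = l *: (n * x).
  have [l [m e]] := quadratic_over_center (n * x); exists l.
  have : n * (n * x * (n * x)) = 0 by rewrite -mulrA nM.
  rewrite e mulrDr -scalerAr nM scaler0 add0r -scalerAr mulr1 => /eqP.
  by rewrite scaler_eq0 (negPf n0) orbF => /eqP ->; rewrite scale0r addr0.
have [[x [l [l0 e]]]|none] := pselect (exists x : S, exists l : K, l != 0 /\
   (n * x) * (n * x) = l *: (n * x) /\ n * x != 0).
  exists (l^-1 *: (n * x)); split.
  - rewrite -scalerAl -scalerAr e.1; congr (_ *: _).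
    by rewrite scalerA mulVf // scale1r.
  - by rewrite scaler_eq0 invr_eq0 (negPf l0) e.2.
  apply/eqP => /(congr1 (fun x => n * x)).
  by rewrite mulr1 -scalerAr nM scaler0 => /esym/eqP; rewrite (negPf n0).
have sq0 x : (n * x) * (n * x) = 0.
  have [l e] := sq x; have [->|nx0] := eqVneq (n * x) 0; first by rewrite mulr0.
  have [l0|l0] := eqVneq l 0; first by rewrite e l0 scale0r.
  by case: none; exists x, l.
have anti x y : n * x * (n * y) * (n * x) = 0.
  have e := sq0 (x + y).
  apply: (@eq_of_diff _ _ _ (n * (x + y) * (n * (x + y)) * (n * x)
    - (n * x) * (n * x) * (n * x) - (n * y) * (n * y) * (n * x)
    - n * y * (n * x * (n * x))) 0).
    by rewrite !sq0 !mul0r mulr0 !subr0.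
  nc_ring.
have prod0 x y : n * x * (n * y) = 0.
  have [|//|nx0] := @simple_prime (n * x * (n * y)) (n * x).
    by move=> z; have := anti x (y * z); rewrite !mulrA.
  by rewrite nx0 mul0r.
have nn x : n * x * n = 0 by have := prod0 x 1; rewrite mulr1.
by case: (simple_prime nn) => h; rewrite h eqxx in n0.
Qed.

(** If u in e S e were not a multiple of e, then u + g (1 - e) would have a
    minimal polynomial of degree three for g outside the spectrum of u. *)
Lemma corner_scalar (e : S) : e * e = e -> e != 0 -> e != 1 ->
  forall x, exists k : K, e * x * e = k *: e.
Proof.
move=> e2 e0 e1 x; set u := e * x * e.
have eu : e * u = u by rewrite /u !mulrA e2.
have ue : u * e = u by rewrite /u -!mulrA e2.
pose f := 1 - e.
have f0 : f != 0 by rewrite subr_eq0 eq_sym.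
have ef : e * f = 0 by rewrite mulrBr mulr1 e2 subrr.
have fe : f * e = 0 by rewrite mulrBl mul1r e2 subrr.
have ff : f * f = f by rewrite {1}/f mulrBl mul1r ef subr0.
have fu : f * u = 0 by rewrite -eu mulrA fe mul0r.
have uf : u * f = 0 by rewrite -ue -mulrA ef mulr0.
clearbody u f.
have [l [m lm]] := quadratic_over_center u.
have m0 : m = 0.
  have := congr1 (fun y => f * y) lm.
  rewrite /= mulrA fu mul0r mulrDr -!scalerAr fu scaler0 add0r mulr1 => /esym/eqP.
  by rewrite scaler_eq0 (negPf f0) orbF => /eqP.
rewrite m0 scale0r addr0 in lm.
have [g [g0 gl]] : exists g : K, g != 0 /\ g != l.
  have [->|l1] := eqVneq l 1; last by exists 1; rewrite oner_neq0 eq_sym.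
  by exists 2; rewrite pnatr_eq0 -subr_eq0 [2]mulr2n addrK oner_neq0.
have [l' [m' e']] := quadratic_over_center (u + g *: f).
have sq : (u + g *: f) * (u + g *: f) = l *: u + (g * g) *: f.
  rewrite mulrDl !mulrDr -!scalerAr -!scalerAl uf fu ff lm !scaler0 addr0 add0r.
  by rewrite scalerA.
rewrite {}sq in e'.
have ee := congr1 (fun y => e * y) e'.
rewrite /= !mulrDr -!scalerAr mulrDr -!scalerAr ef eu mulr1 !scaler0 !addr0 in ee.
have ef' := congr1 (fun y => f * y) e'.
rewrite /= !mulrDr -!scalerAr mulrDr -!scalerAr ff fu mulr1 !scaler0 !add0r in ef'.
have gE : g * g = l' * g + m'.
  move/eqP: ef'; rewrite scalerA -scalerDl -subr_eq0 -scalerBl scaler_eq0 (negPf f0).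
  by rewrite orbF subr_eq0 => /eqP.
have [ll|ll] := eqVneq l l'.
  move: ee; rewrite ll => /esym/eqP; rewrite -subr_eq0 addrC addKr scaler_eq0.
  rewrite (negPf e0) orbF => /eqP m'0; move/eqP: gE.
  by rewrite m'0 addr0 -subr_eq0 -mulrBl mulf_eq0 subr_eq0 -ll (negPf gl) (negPf g0).
exists ((l - l')^-1 * m').
rewrite -scalerA; move/eqP: ee; rewrite addrC -subr_eq -scalerBl => /eqP <-.
by rewrite scalerA mulVf ?subr_eq0 // scale1r.
Qed.

(** The q_i p_j are matrix units, p_i x q_j is the (i,j) entry of x seen in e S e,
    and [c] reads off the scalar. *)
Lemma matrix_units_iso (p q : 'I_2 -> S) (e : S) (c : S -> K) :
  e != 0 ->
  (forall i j, p i * q j = (i == j)%:R *: e) -> \sum_i q i * p i = 1 ->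
  (forall x i j, p i * x * q j = c (p i * x * q j) *: e) ->
  algebra_isomorphic S 'M[K]_2.
Proof.
move=> e0 pq qp cE.
have einj (k k' : K) : k *: e = k' *: e -> k = k'.
  by move=> /eqP; rewrite -subr_eq0 -scalerBl scaler_eq0 (negPf e0) orbF subr_eq0 => /eqP.
pose g x : 'M[K]_2 := \matrix_(i, j) c (p i * x * q j).
pose h (M : 'M[K]_2) : S := \sum_i \sum_j M i j *: (q i * p j).
have pp i : e * p i = p i.
  have := congr1 (fun x => p i * x) qp; rewrite /= mulr1 mulr_sumr => {2}<-.
  rewrite (bigD1 i) //= mulrA pq eqxx scale1r big1 ?addr0 // => j ji.
  by rewrite mulrA pq eq_sym (negPf ji) scale0r mul0r.
have ee : e * e = e.
  by have := pq 0 0; rewrite eqxx scale1r => h00; rewrite -{2 3}h00 mulrA pp.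
apply: (@algebra_isomorphic_of _ _ _ g h).
- move=> x y; apply/matrixP => i j; rewrite !mxE; apply: einj.
  by rewrite -cE scalerDl -!cE mulrDr mulrDl.
- move=> k x; apply/matrixP => i j; rewrite !mxE; apply: einj.
  by rewrite -cE -scalerA -!cE -scalerAr -scalerAl.
- move=> x y; apply/matrixP => i j; rewrite !mxE; apply: einj.
  rewrite -cE scaler_suml.
  transitivity (p i * x * (\sum_k q k * p k) * (y * q j)).
    by rewrite qp mulr1 !mulrA.
  rewrite mulr_sumr mulr_suml; apply: eq_bigr => k _; rewrite !mxE.
  transitivity ((p i * x * q k) * (p k * y * q j)); first by rewrite !mulrA.
  by rewrite [in LHS]cE [X in _ * X]cE -scalerAl -scalerAr scalerA ee.
- apply/matrixP => i j; rewrite !mxE; apply: einj.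
  by rewrite -cE mulr1 pq.
- move=> x; rewrite /h -[RHS]mul1r -[RHS]mulr1 -{1}qp -qp !mulr_suml.
  apply: eq_bigr => i _; rewrite mulr_sumr; apply: eq_bigr => j _.
  transitivity (q i * (p i * x * q j) * p j); last by rewrite !mulrA.
  rewrite mxE [in RHS]cE -scalerAr -scalerAl; congr (_ *: _).
  by rewrite -mulrA pp.
move=> M; apply/matrixP => i j; rewrite !mxE; apply: einj.
rewrite -cE /h mulr_sumr mulr_suml (bigD1 i) //= [X in _ + X]big1 ?addr0.
  rewrite mulr_sumr mulr_suml (bigD1 j) //= [X in _ + X]big1 ?addr0.
    by rewrite -scalerAr -scalerAl mulrA pq eqxx scale1r -mulrA pq eqxx scale1r ee.
  move=> k kj; rewrite -scalerAr -scalerAl mulrA pq eqxx scale1r -mulrA pq.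
  by rewrite (negPf kj) scale0r mulr0 scaler0.
move=> k ki; rewrite mulr_sumr mulr_suml big1 // => l _.
rewrite -scalerAr -scalerAl mulrA pq eq_sym (negPf ki) scale0r !mul0r scaler0 //.
Qed.

Lemma scalar_algebra_iso : (forall t : S, exists k : K, t = k%:A) ->
  algebra_isomorphic S K^o.
Proof.
move=> sc; have [c cE] := choice sc.
have inj (k k' : K) : k%:A = k'%:A :> S -> k = k'.
  by move=> /eqP; rewrite -subr_eq0 -scalerBl scaler_eq0 oner_eq0 orbF subr_eq0 => /eqP.
apply: (@algebra_isomorphic_of _ S K^o c (fun k => k%:A)).
- by move=> x y; apply: inj; rewrite -cE scalerDl -!cE.
- by move=> k x; apply: inj; rewrite -cE -scalerA -cE.
- move=> x y; apply: inj; rewrite -cE {1}(cE x) {1}(cE y).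
  by rewrite -scalerAl mul1r scalerA.
- by apply: inj; rewrite -cE scale1r.
- by move=> x; rewrite -cE.
- by move=> k; apply: inj; rewrite -cE.
Qed.

(** A nontrivial idempotent e has scalar corners e S e and (1 - e) S (1 - e), and
    simplicity provides a in e S (1 - e) and b in (1 - e) S e with ab = e and
    ba = 1 - e. *)
Lemma quadratic_simple_iso :
  algebra_isomorphic S K^o \/ algebra_isomorphic S 'M[K]_2.
Proof.
have [sc|] := pselect (forall t : S, exists k : K, t = k%:A).
  by left; exact: scalar_algebra_iso.
move=> /existsNP[t nt]; right.
have [|e [e2 e0 e1]] := @nontrivial_idempotent t.
  by move=> k; apply/eqP => tk; apply: nt; exists k.
pose f := 1 - e.
have f0 : f != 0 by rewrite subr_eq0 eq_sym.
have f1 : f != 1.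
  by apply: contra e0 => /eqP h; rewrite -[e](subKr 1) -/f h subrr.
have ef : e * f = 0 by rewrite mulrBr mulr1 e2 subrr.
have fe : f * e = 0 by rewrite mulrBl mul1r e2 subrr.
have ff : f * f = f by rewrite {1}/f mulrBl mul1r ef subr0.
have efD : e + f = 1 by rewrite addrC subrK.
have [x exf] : exists x, e * x * f != 0.
  apply: contrapT => /forallNP h.
  have [|h'|h'] := @simple_prime e f.
  - by move=> x; apply/eqP/negPn/negP => /h.
  - by rewrite h' eqxx in e0.
  - by rewrite h' eqxx in f0.
have [y exfye] : exists y, (e * x * f) * y * e != 0.
  apply: contrapT => /forallNP h.
  have [|h'|h'] := @simple_prime (e * x * f) e.
  - by move=> y; apply/eqP/negPn/negP => /h.
  - by rewrite h' eqxx in exf.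
  - by rewrite h' eqxx in e0.
pose a := e * x * f; pose b := f * y * e.
have [k abk] := corner_scalar e2 e0 e1 (x * f * y).
have k0 : k != 0.
  apply: contra exfye => /eqP h; rewrite h scale0r in abk.
  by rewrite -[X in X == _]mul1r -abk mulrA !mul1r -!mulrA.
have fc : forall z, exists k : K, f * z * f = k *: f by exact: corner_scalar.
have ab : a * (k^-1 *: b) = e.
  rewrite -scalerAr.
  have -> : a * b = e * (x * f * y) * e by rewrite /a /b !mulrA -(mulrA _ f f) ff.
  by rewrite abk scalerA mulVf // scale1r.
set b' := k^-1 *: b in ab.
have b'e : b' * e = b' by rewrite /b' /b -scalerAl -!mulrA e2.
have fb' : f * b' = b' by rewrite /b' /b -scalerAr !mulrA ff.
have ea : e * a = a by rewrite /a !mulrA e2.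
have af : a * f = a by rewrite /a -!mulrA ff.
have b'0 : b' != 0 by apply: contra e0 => /eqP h; rewrite -ab h mulr0.
have ba : b' * a = f.
  have [l lE] := fc (b' * a); rewrite mulrA fb' -mulrA af in lE.
  have : b' * a * b' = b' by rewrite -mulrA ab.
  rewrite lE -scalerAl fb' => /eqP; rewrite -subr_eq0 -{2}[b']scale1r -scalerBl.
  by rewrite scaler_eq0 (negPf b'0) orbF subr_eq0 => /eqP ->; rewrite scale1r.
clearbody f a b'.
have eb : e * b' = 0 by rewrite -fb' mulrA ef mul0r.
have ae : a * e = 0 by rewrite -af -mulrA fe mulr0.
pose p (i : 'I_2) := if i == 0 then e else a.
pose q (i : 'I_2) := if i == 0 then e else b'.
have ep i : e * p i = p i by rewrite /p; case: ifP.
have qe i : q i * e = q i by rewrite /q; case: ifP.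
have cex z : exists c : K, e * z * e = c *: e by exact: corner_scalar.
have [c cE] := choice cex.
apply: (@matrix_units_iso p q e c) => //.
- move=> i j; rewrite /p /q.
  have two (l : 'I_2) : l = 0 \/ l = 1.
    by case: l => [[|[|//]] hl]; [left|right]; apply: val_inj.
  by case: (two i) => ->; case: (two j) => -> /=; rewrite ?scale1r ?scale0r.
- by rewrite big_ord_recl big_ord1 /p /q /= e2 ba.
move=> z i j.
by rewrite -cE !mulrA ep -!mulrA qe.
Qed.

End SimpleQuadratic.

(** * The Gelfand-Mazur theorem for a seminorm *)
Lemma primitive_root_exists (K : numClosedFieldType) n : (0 < n)%N ->
  exists w : K, n.-primitive_root w.
Proof.
move=> n0; have [r] := closed_field_poly_normal ('X^n - 1 : {poly K}).
rewrite (monicP _) ?monicXnsubC // scale1r => rE.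
have roots : all n.-unity_root r.
  by apply/allP => w wr; rewrite /root_of_unity rE root_prod_XsubC.
have sz : (n <= size r)%N.
  by rewrite -ltnS -(size_prod_XsubC r id) -rE size_XnsubC.
have uniq_r : uniq r.
  by rewrite -separable_prod_XsubC -rE separable_Xn_sub_1 // pnatr_eq0 -lt0n.
by have /hasP[w _ w_prim] := has_prim_root n0 roots uniq_r sz; exists w.
Qed.

Section ComplexAbs.
Variable R : realType.
Local Notation K := R[i].

(** The absolute value of R[i] takes its values in R[i]; this is its real version. *)
Definition cabs (k : K) : R := complex.Re `|k|.

Lemma cabsE k : `|k| = (cabs k)%:C%C.
Proof. by rewrite /cabs normc_def. Qed.

Lemma cabs_ge0 k : 0 <= cabs k.
Proof. by rewrite -lecR -cabsE normr_ge0. Qed.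

Lemma cabsM k l : cabs (k * l) = cabs k * cabs l.
Proof. by apply: complexI; rewrite rmorphM /= -!cabsE normrM. Qed.

Lemma cabsX k n : cabs (k ^+ n) = cabs k ^+ n.
Proof. by apply: complexI; rewrite rmorphXn /= -!cabsE normrX. Qed.

Lemma cabsN k : cabs (- k) = cabs k.
Proof. by rewrite /cabs normrN. Qed.

Lemma cabs1 : cabs 1 = 1.
Proof. by apply: complexI; rewrite -cabsE normr1. Qed.

Lemma cabs_real (r : R) : 0 <= r -> cabs (r%:C)%C = r.
Proof. by move=> r0; apply: complexI; rewrite -cabsE ger0_norm // lecR. Qed.

Lemma cabs_ge_Re k : `|complex.Re k| <= cabs k.
Proof. by rewrite -lecR -cabsE normc_ge_Re. Qed.

Lemma cabs_ge_Im k : `|complex.Im k| <= cabs k.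
Proof.
rewrite -lecR -cabsE normc_def lecR -[leLHS]sqrtr_sqr ler_wsqrtr //.
by rewrite lerDr sqr_ge0.
Qed.

Lemma cabs_le_sum k : cabs k <= `|complex.Re k| + `|complex.Im k|.
Proof.
rewrite /cabs normc_def /=.
rewrite -[leRHS]ger0_norm ?addr_ge0 // -sqrtr_sqr ler_wsqrtr //.
rewrite sqrrD !real_normK ?num_real // -addrA lerD2l lerDr.
by rewrite mulrn_wge0 // mulr_ge0.
Qed.

End ComplexAbs.

(** [q] is a submultiplicative seminorm, possibly with a kernel, and [res] is the
    resolvent of an element [x] of empty spectrum. *)
Section GelfandMazur.
Variables (R : realType) (S : algType R[i]) (q : S -> R).
Local Notation K := R[i].
Hypothesis q_ge0 : forall x, 0 <= q x.
Hypothesis qD : forall x y, q (x + y) <= q x + q y.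
Hypothesis qM : forall x y, q (x * y) <= q x * q y.
Hypothesis qZ : forall k x, q (k *: x) = cabs k * q x.
Hypothesis q1 : 0 < q 1.

Lemma seminormN x : q (- x) = q x.
Proof. by rewrite -scaleN1r qZ cabsN cabs1 mul1r. Qed.

Lemma seminorm_dist x y : `|q x - q y| <= q (x - y).
Proof.
rewrite ler_norml; apply/andP; split.
  by have := qD (y - x) x; rewrite subrK -(seminormN (y - x)) opprB; lra.
by have := qD (x - y) y; rewrite subrK; lra.
Qed.

Lemma seminorm_sum n (F : 'I_n -> S) : q (\sum_i F i) <= \sum_i q (F i).
Proof.
elim/big_ind2: _ => //; last by move=> x a y b *; apply: le_trans (qD _ _) (lerD _ _).
by rewrite -(scale0r (1 : S)) qZ /cabs normr0 mul0r.
Qed.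

Lemma seminormX x n : (0 < n)%N -> q (x ^+ n) <= q x ^+ n.
Proof.
case: n => // n _; elim: n => [|n IH]; first by rewrite !expr1.
by rewrite exprS [leRHS]exprS; apply: le_trans (qM _ _) _; rewrite ler_wpM2l.
Qed.

Variables (x : S) (res : K -> S).
Hypothesis resl : forall k, (x - k%:A) * res k = 1.
Hypothesis resr : forall k, res k * (x - k%:A) = 1.

Lemma resolvent_identity a b : res a - res b = (a - b) *: (res a * res b).
Proof.
have -> : res a - res b = res a * ((x - b%:A) - (x - a%:A)) * res b.
  by rewrite mulrBr mulrBl resr mul1r -mulrA resl mulr1.
by rewrite opprB addrC addrA subrK -scalerBl -scalerAr mulr1 -scalerAl.
Qed.

Local Notation f := (fun k => q (res k)).

Lemma resolvent_norm_gt0 k : 0 < f k.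
Proof.
rewrite lt_neqAle q_ge0 andbT eq_sym; apply/eqP => f0.
have := qM (x - k%:A) (res k); rewrite resl f0 mulr0.
by rewrite leNgt q1.
Qed.

Lemma resolvent_norm_dist a b : `|f a - f b| <= cabs (a - b) * (f a * f b).
Proof.
apply: le_trans (seminorm_dist _ _) _; rewrite resolvent_identity qZ.
by rewrite ler_wpM2l // cabs_ge0.
Qed.

Lemma resolvent_norm_decay k d : 0 < d -> q x + q 1 / d < cabs k -> f k < d.
Proof.
move=> d0 hk.
have kE : k *: res k = x * res k - 1.
  by rewrite -(resl k) mulrBl subKr -scalerAl mul1r.
have : cabs k * f k <= q x * f k + q 1.
  rewrite -qZ kE; apply: le_trans (qD _ _) _; rewrite seminormN lerD2r; exact: qM.
move=> h; rewrite ltNge; apply/negP => dk.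
have f0 := resolvent_norm_gt0 k.
have : q x * f k + q 1 / d * f k < cabs k * f k by rewrite -mulrDl ltr_pM2r.
have : q 1 <= q 1 / d * f k.
  by rewrite -mulrA ler_peMr ?(ltW q1) // ler_pdivlMl // mulr1.
lra.
Qed.

(** The norm of the resolvent is continuous by the resolvent identity and smaller
    than its value at 0 outside a large square. *)
Lemma resolvent_norm_max : exists c, forall k, f k <= f c.
Proof.
pose g (p : R * R) := f (p.1 +i* p.2)%C.
have gc : continuous g.
  move=> p; apply/cvgrPdist_lt => e e0.
  pose F := g p; have F0 : 0 < F by exact: resolvent_norm_gt0.
  pose d := Num.min (1 / (4 * F)) (e / (4 * F ^+ 2)).
  have d0 : 0 < d by rewrite lt_min !divr_gt0 // ?mulr_gt0 ?exprn_gt0.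
  have : nbhs p (ball p.1 d `*` ball p.2 d).
    by exists (ball p.1 d, ball p.2 d) => //=; split; exact: nbhsx_ballx.
  apply: filterS => p' [] /= h1 h2.
  pose C := cabs ((p.1 +i* p.2)%C - (p'.1 +i* p'.2)%C).
  have C2 : C < 2 * d.
    apply: le_lt_trans (cabs_le_sum _) _ => /=.
    by rewrite mulr2n mulrDl mul1r ltrD.
  have G0 : 0 < g p' by exact: resolvent_norm_gt0.
  have : `|F - g p'| <= C * F * g p'.
    by rewrite -mulrA; exact: resolvent_norm_dist.
  have dF : d * (4 * F) <= 1.
    by rewrite -ler_pdivlMr ?mulr_gt0 // ge_min lexx.
  have dF2 : d * (4 * F ^+ 2) <= e.
    by rewrite -ler_pdivlMr ?mulr_gt0 ?exprn_gt0 // ge_min lexx orbT.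
  have CF : C * F < 2 * d * F by rewrite ltr_pM2r.
  move=> h.
  have h3 : C * F * g p' <= 1 / 2 * g p' by rewrite ler_pM2r //; lra.
  have G2 : g p' <= 2 * F.
    by move: h; rewrite ler_norml => /andP[]; lra.
  apply: le_lt_trans h _; apply: lt_le_trans dF2.
  have C0 : 0 <= C by exact: cabs_ge0.
  apply: le_lt_trans (_ : C * F * (2 * F) < _).
    by rewrite ler_wpM2l // mulr_ge0 // ltW.
  have -> : d * (4 * F ^+ 2) = 2 * d * F * (2 * F) by ring.
  by rewrite ltr_pM2r // mulr_gt0.
pose L := q x + q 1 / f 0 + 1.
have L0 : 0 <= L.
  by rewrite /L !addr_ge0 // divr_ge0 // ltW.
have [|||c cB cmax] := @compact_EVT_max _ R g (`[- L, L] `*` `[- L, L]).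
- exists (0, 0); split; rewrite /= in_itv /= oppr_le0 L0 //.
- exact: compact_setX (@segment_compact _ _ _) (@segment_compact _ _ _).
- exact: continuous_subspaceT.
exists (c.1 +i* c.2)%C => k.
have [Bk|Bk] := boolP ((complex.Re k, complex.Im k) \in (`[- L, L] `*` `[- L, L] : set (R * R))).
  by have := cmax _ Bk; rewrite /g /=; case: k Bk.
have f0c : f 0 <= g c.
  apply: (cmax (0, 0)); apply/mem_set; split; rewrite /= in_itv /= oppr_le0 L0 //.
apply: le_trans f0c; apply/ltW/resolvent_norm_decay; first exact: resolvent_norm_gt0.
rewrite ltNge; apply: contra Bk => kL.
apply/mem_set; split; rewrite /= in_itv /= -ler_norml.
  by apply: le_trans (cabs_ge_Re k) _; rewrite /L; lra.
by apply: le_trans (cabs_ge_Im k) _; rewrite /L; lra.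
Qed.


Lemma primitive_power_sum n (w : K) i : n.-primitive_root w -> (i < n)%N ->
  \sum_(j < n) w ^+ (i * j) = if i == 0%N then n%:R else 0.
Proof.
move=> wn i_n; have n0 := prim_order_gt0 wn.
case: eqP => [->|/eqP i0].
  by under eq_bigr do rewrite mul0n expr0; rewrite sumr_const card_ord.
have wi1 : w ^+ i - 1 != 0.
  rewrite subr_eq0 -(prim_order_dvd wn); apply/negP => /dvdn_leq.
  by rewrite lt0n i0 leqNgt i_n => /(_ isT).
apply: (mulfI wi1); rewrite mulr0.
under eq_bigr do rewrite exprM.
by rewrite -subrX1 -exprM mulnC exprM (prim_expr_order wn) expr1n subrr.
Qed.

(** An algebraic mean value property: with y = x - k, each res (k + r w^j) times
    y^n - r^n is the sum of the r^i w^(i j) y^(n-1-i), and summing over j kills all the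
    terms but i = 0. *)
Lemma resolvent_circle_mean k (r : R) n (w : K) : n.-primitive_root w ->
  (\sum_(j < n) res (k + r%:C%C * w ^+ j)) * (1 - (r%:C%C ^+ n) *: res k ^+ n)
  = n%:R *: res k.
Proof.
move=> wn; have n0 := prim_order_gt0 wn.
pose y := x - k%:A; pose c j : K := r%:C%C * w ^+ j.
have cn j : c j ^+ n = r%:C%C ^+ n.
  by rewrite exprMn -exprM mulnC exprM (prim_expr_order wn) expr1n mulr1.
have comm (a : K) : GRing.comm y a%:A by rewrite /GRing.comm mulr_algl mulr_algr.
have term j : res (k + c j) * (y ^+ n - (r%:C%C ^+ n)%:A) =
    \sum_(i < n) c j ^+ i *: y ^+ (n.-1 - i).
  have -> : (r%:C%C ^+ n)%:A = (c j)%:A ^+ n :> S.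
    by rewrite exprZn expr1n cn.
  rewrite (subrXX_comm _ (comm _)).
  have -> : y - (c j)%:A = x - (k + c j)%:A by rewrite scalerDl opprD addrA.
  rewrite mulrA resr mul1r; apply: eq_bigr => i _.
  by rewrite exprZn expr1n mulr_algr.
have wy : res k * y = 1 by exact: resr.
have yw : y * res k = 1 by exact: resl.
have ywX m : y ^+ m * res k ^+ m = 1.
  rewrite -exprMn_comm ?yw ?expr1n //.
  by rewrite /GRing.comm yw wy.
have sumE : (\sum_(j < n) res (k + c j)) * (y ^+ n - (r%:C%C ^+ n)%:A) =
    n%:R *: y ^+ n.-1.
  rewrite mulr_suml; under eq_bigr do rewrite term.
  rewrite exchange_big /=.
  under eq_bigr => i _.
    rewrite -scaler_suml.
    under eq_bigr do rewrite exprMn -exprM mulnC.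
    rewrite -mulr_sumr (primitive_power_sum wn (ltn_ord i)).
    over.
  rewrite (bigD1 (Ordinal n0)) //= expr0 mul1r subn0 big1 ?addr0 //.
  by move=> i; rewrite -val_eqE /= => /negPf ->; rewrite mulr0 scale0r.
have := congr1 (fun z => z * res k ^+ n) sumE.
rewrite /= -mulrA mulrBl ywX mulr_algl => ->.
rewrite -scalerAl; congr (_ *: _).
by rewrite -(prednK n0) /= exprSr mulrA ywX mul1r.
Qed.

(** The radius r = 1 / (2 M) makes the seminorm of r^n (res k)^n at most 2^-n.  The
    mean of the n values on the circle then has seminorm at least M - M / 2^n, so the
    value at k + r, which is one of them, cannot be smaller than M by more than
    n M / 2^n. *)
Lemma resolvent_norm_max_shift M k : 0 < M -> (forall l, f l <= M) ->
  f k = M -> f (k + (1 / (2 * M))%:C%C) = M.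
Proof.
move=> M0 fM fk; set r := 1 / (2 * M).
have r0 : 0 < r by rewrite divr_gt0 // mulr_gt0.
have rM : r * M = 1 / 2 by rewrite /r; field; apply: lt0r_neq0.
apply/eqP; rewrite eq_le fM leNgt; apply/negP => lt.
pose d := M - f (k + r%:C%C).
have d0 : 0 < d by rewrite subr_gt0.
have bound n : (0 < n)%N -> d <= n%:R * M / 2 ^+ n.
  move=> n0; have [w wn] := @primitive_root_exists K n n0.
  have := resolvent_circle_mean k r wn.
  set s := \sum_(j < n) _ => sE.
  have qs : q s <= n%:R * M - d.
    apply: le_trans (seminorm_sum _) _; rewrite lerBrDl -lerBrDr.
    have -> : n%:R * M = \sum_(j < n) M by rewrite sumr_const card_ord mulr_natl.
    rewrite -sumrB (bigD1 (Ordinal n0)) //= expr0 mulr1 -/d lerDl.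
    by apply: sumr_ge0 => j _; rewrite subr_ge0.
  have cn : cabs (n%:R : K) = n%:R.
    by rewrite -[RHS](@cabs_real R) ?ler0n // rmorph_nat.
  have qn : n%:R * M <= q s + q s * (r ^+ n * M ^+ n).
    rewrite -cn -fk -qZ -sE mulrBr mulr1 -scalerAr; apply: le_trans (qD _ _) _.
    rewrite seminormN lerD2l qZ cabsX (cabs_real (ltW r0)) mulrCA.
    rewrite ler_wpM2l ?exprn_ge0 ?(ltW r0) //; apply: le_trans (qM _ _) _.
    by rewrite ler_wpM2l // seminormX.
  rewrite -exprMn rM expr_div_n expr1n in qn.
  apply: le_trans (_ : q s * (1 / 2 ^+ n) <= _); first by lra.
  rewrite mulrA mulr1 ler_pM2r ?invr_gt0 ?exprn_gt0 //; lra.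
pose m := (Num.truncn (2 * M / d)).+1.
have md : 2 * M < m%:R * d by rewrite -ltr_pdivrMr // truncnS_gt.
have := bound (m + m)%N isT.
rewrite natrD exprD ler_pdivlMr ?mulr_gt0 ?exprn_gt0 //.
set X : R := 2 ^+ m; have X0 : 0 < X by rewrite exprn_gt0.
have mX : m%:R <= X by rewrite /X -natrX ler_nat ltnW // ltn_expl.
move=> h.
have : d * X * X <= 2 * M * X.
  rewrite -mulrA; apply: le_trans h _.
  have : m%:R * M <= X * M by rewrite ler_pM2r.
  lra.
rewrite ler_pM2r // => h2.
have : d * m%:R <= d * X by rewrite ler_pM2l.
lra.
Qed.

(** The maximum M of the norm of the resolvent propagates along the translates by
    1 / (2 M) and contradicts the decay at infinity. *)
Theorem gelfand_mazur : False.
Proof.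
have [c cmax] := resolvent_norm_max.
pose M := f c; have M0 : 0 < M by exact: resolvent_norm_gt0.
pose r := 1 / (2 * M); have r0 : 0 < r by rewrite divr_gt0 // mulr_gt0.
have shift n : f (c + (n%:R * r)%:C%C) = M.
  elim: n => [|n IH]; first by rewrite mul0r addr0.
  have := resolvent_norm_max_shift M0 cmax IH.
  by rewrite -addrA -rmorphD /= -/r -{2}[r]mul1r -mulrDl -natr1.
pose b := (q x + q 1 / M + `|complex.Re c|) / r.
have := shift (Num.truncn b).+1 => e.
have : f (c + ((Num.truncn b).+1%:R * r)%:C%C) < M.
  apply: resolvent_norm_decay => //.
  apply: lt_le_trans (cabs_ge_Re _); rewrite raddfD /=.
  have : b * r < (Num.truncn b).+1%:R * r by rewrite ltr_pM2r // truncnS_gt.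
  rewrite /b mulrVK ?unitfE ?lt0r_neq0 // => h.
  apply: lt_le_trans (ler_norm _); have := ler_norm (- complex.Re c).
  rewrite normrN; lra.
by rewrite e ltxx.
Qed.

End GelfandMazur.

(** * Maximal ideals and quotients of Banach algebras *)

(** Zorn's lemma is applied to the sets whose union with [I] is a proper ideal, so
    that the empty chain needs no separate bound. *)
Lemma maximal_two_sided (B : pzRingType) (I : set B) : two_sided I -> ~ I 1 ->
  exists M : set B, [/\ two_sided M, I `<=` M, ~ M 1 &
    forall M', two_sided M' -> M `<=` M' -> ~ M' 1 -> M' `<=` M].
Proof.
move=> iI I1.
pose P (X : set B) := two_sided (I `|` X) /\ ~ (I `|` X) 1.
have [F FP Ftot|X [[iX X1] Xmax]] := @Zorn_bigcup B P.
  split; last by move=> [//|[X /FP[_ X1] Xx]]; apply: X1; right.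
  case: (iI) => I0 ID Il Ir; split.
  - by left.
  - move=> x y [Ix|[X FX Xx]] [Iy|[Y FY Yy]].
    + by left; exact: ID.
    + have [[_ D _ _] _] := FP _ FY.
      by have [|] := D x y (or_introl Ix) (or_intror Yy); [left|right; exists Y].
    + have [[_ D _ _] _] := FP _ FX.
      by have [|] := D x y (or_intror Xx) (or_introl Iy); [left|right; exists X].
    have [XY|YX] := Ftot _ _ FX FY.
      have [[_ D _ _] _] := FP _ FY.
      by have [|] := D x y (or_intror (XY _ Xx)) (or_intror Yy); [left|right; exists Y].
    have [[_ D _ _] _] := FP _ FX.
    by have [|] := D x y (or_intror Xx) (or_intror (YX _ Yy)); [left|right; exists X].
  - move=> a x [Ix|[X FX Xx]]; first by left; exact: Il.
    have [[_ _ l _] _] := FP _ FX.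
    by have [|] := l a x (or_intror Xx); [left|right; exists X].
  - move=> a x [Ix|[X FX Xx]]; first by left; exact: Ir.
    have [[_ _ _ r] _] := FP _ FX.
    by have [|] := r a x (or_intror Xx); [left|right; exists X].
exists (I `|` X); split=> // M iM XM M1.
have IM : I `|` M = M.
  by apply/seteqP; split=> x; [case=> // Ix; apply: XM; left|right].
have [XeqM|XneqM] := pselect (M `<=` X); first by move=> x /XeqM; right.
case: (Xmax M); last by rewrite /P IM.
by split=> // x Xx; apply: XM; right.
Qed.

(** If n is outside a maximal left ideal L, then 1 = l + b n with l in L, and
    (1 + b n) l = 1 - (b n)^2 = 1 lies in L. *)
Lemma semisimple_semiprime (B : pzRingType) (n : B) : semisimple B ->
  (forall b, (b * n) * (b * n) = 0) -> n = 0.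
Proof.
move=> ss n0; suff : jacobson_radical B n by rewrite ss.
move=> L [[L0 LD Ll] LT Lmax]; apply: contrapT => Ln.
pose M : set B := [set x | exists l b, L l /\ x = l + b * n].
have lM : left_ideal M.
  split.
  - by exists 0, 0; rewrite mul0r addr0.
  - move=> x y [l [b [Ll' ->]]] [l' [b' [Ll'' ->]]].
    by exists (l + l'), (b + b'); split; [exact: LD|nc_ring].
  - move=> a x [l [b [Ll' ->]]].
    by exists (a * l), (a * b); split; [exact: Ll|nc_ring].
have LM : L `<=` M by move=> l Ll'; exists l, 0; rewrite mul0r addr0.
have Mn : M n by exists 0, 1; rewrite mul1r add0r.
case: (Lmax M lM LM) => [ML|MT]; first by apply: Ln; rewrite -ML.
have [l [b [Ll' e]]] : M 1 by rewrite MT.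
apply: LT; apply/seteqP; split=> // x _.
have -> : x = x * (1 + b * n) * l.
  apply: (eq_of_diff (congr1 (fun y => x * (1 + b * n) * y) e)).
  have := n0 b; move: (b * n) => m m2.
  apply: (@eq_of_diff _ _ _ (x * (m * m)) 0); first by rewrite m2 mulr0.
  nc_ring.
exact: Ll.
Qed.

Section BanachNorm.
Variables (R : realType) (B : banachAlgType R[i]).
Local Notation K := R[i].

(** The norm of the algebra, which takes its values in R[i], as a real number. *)
Definition nrm (x : B) : R := complex.Re `|to_space B x|.

Lemma nrmE x : `|to_space B x| = (nrm x)%:C%C.
Proof.
rewrite /nrm; have := normr_ge0 (to_space B x).
by move: `|_| => [a b]; rewrite lecE /= => /andP[/eqP -> _].
Qed.

Lemma nrm_ge0 x : 0 <= nrm x.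
Proof. by rewrite -lecR -nrmE normr_ge0. Qed.

Lemma nrmD x y : nrm (x + y) <= nrm x + nrm y.
Proof. by rewrite -lecR rmorphD /= -!nrmE raddfD ler_normD. Qed.

Lemma nrmM x y : nrm (x * y) <= nrm x * nrm y.
Proof. by rewrite -lecR rmorphM /= -!nrmE to_space_normM. Qed.

Lemma nrmZ k x : nrm (k *: x) = cabs k * nrm x.
Proof. by apply: complexI; rewrite rmorphM /= -!nrmE -cabsE linearZ normrZ. Qed.

Lemma nrm_eq0 x : nrm x = 0 -> x = 0.
Proof.
move=> x0; apply: (bij_inj (to_space_bij B)); rewrite raddf0.
by apply/eqP; rewrite -normr_eq0 nrmE x0.
Qed.

Lemma nrmN x : nrm (- x) = nrm x.
Proof. by rewrite -scaleN1r nrmZ cabsN cabs1 mul1r. Qed.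

Lemma nrm_cauchy_cvg (u : nat -> B) :
  (forall e, 0 < e -> exists N, forall m n, (N <= m)%N -> (N <= n)%N ->
     nrm (u m - u n) < e) ->
  exists y, forall e, 0 < e -> exists N, forall n, (N <= n)%N -> nrm (y - u n) < e.
Proof.
move=> uc; pose v n := to_space B (u n).
have vc : cauchy (v @ \oo).
  apply/cauchy_ballP => e e0.
  have eE : e = (complex.Re e)%:C%C.
    by move: e0; case: e => a b; rewrite ltcE /= => /andP[/eqP -> _].
  have re0 : 0 < complex.Re e by rewrite -ltcR -eE.
  have [N HN] := uc _ re0.
  exists ([set z | exists2 n, (N <= n)%N & z = v n], [set z | exists2 n, (N <= n)%N & z = v n]).
    by split; exists N => // n Nn; exists n.
  move=> [_ _] [[m Nm ->] [n Nn ->]] /=.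
  by rewrite -ball_normE /= -raddfB nrmE eE ltcR; exact: HN.
have /cvg_ex[l vl] : cvg (v @ \oo) by exact/cauchy_cvgP.
have [g _ gK] := to_space_bij B; exists (g l) => e e0.
have e0' : 0 < e%:C%C :> K by rewrite ltcR.
have := (cvgrPdist_lt _ _).1 vl _ e0' => -[N _ h].
exists N => n Nn; have := h n Nn.
by rewrite -ltcR -nrmE raddfB /= gK.
Qed.

(** The sum of the powers of x, whose tails are dominated by those of a geometric
    series of ratio 1 / 2. *)
Lemma neumann (x : B) : nrm x <= 1 / 2 -> exists y, (1 - x) * y = 1.
Proof.
move=> x2; pose C := nrm 1; have C0 : 0 <= C := nrm_ge0 1.
have xk k : nrm (x ^+ k) <= C / 2 ^+ k.
  elim: k => [|k IH]; first by rewrite expr0 divr1.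
  rewrite exprS; apply: le_trans (nrmM _ _) _.
  apply: le_trans (ler_pM (nrm_ge0 _) (nrm_ge0 _) x2 IH) _.
  by rewrite exprS invfM [leRHS]mulrCA mul1r.
pose S n := \sum_(k < n) x ^+ k.
have Sk n k : nrm (S (n + k)%N - S n) <= C * 2 / 2 ^+ n - C * 2 / 2 ^+ (n + k).
  elim: k => [|k IH]; first by rewrite addn0 !subrr -(scale0r (1 : B)) nrmZ /cabs normr0 mul0r.
  rewrite addnS /S big_ord_recr /= addrAC; apply: le_trans (nrmD _ _) _.
  have := xk (n + k)%N.
  have -> : C * 2 / 2 ^+ (n + k).+1 = C / 2 ^+ (n + k).
    by rewrite exprS invfM mulrA mulfK ?pnatr_eq0.
  have h2 : C * 2 / 2 ^+ (n + k) = C / 2 ^+ (n + k) + C / 2 ^+ (n + k).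
    by rewrite -mulrDl mulr2n mulrDr mulr1.
  rewrite h2 in IH; rewrite -/(S _) -/(S n); lra.
have small e : 0 < e -> exists N, forall n, (N <= n)%N -> C * 2 / 2 ^+ n < e.
  move=> e0; exists (Num.truncn (C * 2 / e)).+1 => n Nn.
  rewrite ltr_pdivrMr ?exprn_gt0 // [ltRHS]mulrC -ltr_pdivrMr //.
  apply: lt_le_trans (truncnS_gt _) _.
  have : (n%:R : R) <= 2 ^+ n by rewrite -natrX ler_nat ltnW // ltn_expl.
  by apply: le_trans; rewrite ler_nat.
have [y yS] : exists y, forall e, 0 < e -> exists N, forall n, (N <= n)%N -> nrm (y - S n) < e.
  apply: nrm_cauchy_cvg => e e0; have [N HN] := small _ e0.
  exists N; suff W m n : (N <= m)%N -> (m <= n)%N -> nrm (S n - S m) < e.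
    move=> m n Nm Nn; have [mn|/ltnW nm] := leqP m n; last exact: W.
    by rewrite -opprB nrmN; exact: W.
  move=> Nm mn; rewrite -(subnKC mn); apply: le_lt_trans (Sk _ _) _.
  apply: le_lt_trans (HN m Nm); rewrite gerBl.
  by rewrite divr_ge0 ?mulr_ge0 // exprn_ge0.
exists y; apply/eqP; rewrite -subr_eq0; apply/eqP; apply: nrm_eq0; apply/eqP.
rewrite eq_le nrm_ge0 andbT; apply/ler_addgt0Pr => e e0; rewrite add0r.
pose D := nrm (1 - x) + 1.
have D0 : 0 < D by rewrite ltr_wpDl // nrm_ge0.
have [|N1 H1] := yS (e / (2 * D)); first by rewrite divr_gt0 // mulr_gt0.
have [|N2 H2] := small (e / 2); first by rewrite divr_gt0.
pose n := maxn N1 N2.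
have h1 := H1 n (leq_maxl _ _); have h2 := H2 n (leq_maxr _ _).
have -> : (1 - x) * y - 1 = (1 - x) * (y - S n) - x ^+ n.
  have e1 : (1 - x) * S n = 1 - x ^+ n.
    by rewrite /S -(opprB x) mulNr -subrX1 opprB.
  by apply: (eq_of_diff e1); nc_ring.
apply: le_trans (nrmD _ _) _; rewrite nrmN.
have h3 : nrm ((1 - x) * (y - S n)) <= e / 2.
  apply: le_trans (nrmM _ _) _.
  apply: le_trans (_ : D * (e / (2 * D)) <= _).
    by apply: ler_pM; rewrite ?nrm_ge0 // ?(ltW h1) // lerDl.
  have -> // : D * (e / (2 * D)) = e / 2 by field; exact: lt0r_neq0.
have := xk n; have : C / 2 ^+ n <= C * 2 / 2 ^+ n.
  by rewrite ler_pM2r ?invr_gt0 ?exprn_gt0 // ler_peMr // ler1n.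
lra.
Qed.
End BanachNorm.

Lemma two_sided_ideal_of (A : nzRingType) (M : set A) : two_sided M -> ~ M 1 ->
  exists I : twoSidedIdeal A, forall x, x \in I = `[< M x >].
Proof.
move=> iM M1; pose p (x : A) := `[< M x >].
have pE x : x \in p = `[< M x >] by [].
have cl : idealr_closed p.
  case: iM => M0 MD Ml Mr; split; rewrite ?pE.
  - exact/asboolP.
  - exact/asboolP.
  - move=> a u v; rewrite !pE => /asboolP Mu /asboolP Mv.
    by apply/asboolP/MD => //; exact: Ml.
have mr a x : x \in p -> x * a \in p.
  by rewrite !pE => /asboolP Mx; apply/asboolP; case: iM => _ _ _; exact.
pose m1 := isIdealr.Build A p cl.
pose m2 := isMulrClosedIdeal.Build A p mr.
pose I : twoSidedIdeal A := HB.pack p m1 m2.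
by exists I.
Qed.

Section MaximalQuotient.
Variables (R : realType) (B : banachAlgType R[i]) (I : twoSidedIdeal B).
Local Notation K := R[i].
Local Notation Q := (quotient_algebra I).
Local Notation pi := (qa_pi I).
Hypothesis maxI : forall M : set B, two_sided M -> (forall x, x \in I -> M x) ->
  ~ M 1 -> forall x, M x -> x \in I.

Lemma qa_pi_mul x y : pi (x * y) = pi x * pi y.
Proof. exact: qa_piM. Qed.

Lemma qa_pi_one : pi 1 = 1.
Proof. by []. Qed.

Lemma qa_pi_add x y : pi (x + y) = pi x + pi y.
Proof. exact: qa_piD. Qed.

Lemma qa_pi_opp x : pi (- x) = - pi x.
Proof. by rewrite /qa_pi raddfN. Qed.

Lemma qa_pi_scale (k : K) (x : B) : pi (k *: x) = k *: pi x.
Proof. exact: qa_piZ. Qed.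

Lemma qa_pi_eq0 x : (pi x = 0) <-> (x \in I).
Proof.
have -> : 0 = pi 0 by rewrite /qa_pi raddf0.
by rewrite qa_pi_eq subr0.
Qed.

Lemma quotient_simple (J : set Q) : two_sided J -> forall x, J x -> x != 0 ->
  forall b, J b.
Proof.
move=> iJ s Js s0 b; have [x xE] := qa_piP s.
pose M : set B := [set a | J (pi a)].
case: (iJ) => J0 JD Jl Jr.
have iM : two_sided M.
  split=> /= [|a c|a c|a c]; rewrite /M /=.
  - by rewrite (_ : pi 0 = 0) //; apply/qa_pi_eq0; exact: rpred0.
  - by rewrite qa_pi_add; exact: JD.
  - by rewrite qa_pi_mul; exact: Jl.
  - by rewrite qa_pi_mul; exact: Jr.
have IM c : c \in I -> M c by move=> /qa_pi_eq0; rewrite /M /= => ->.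
have [M1|M1] := pselect (M 1); first by rewrite -[b]mulr1; exact: Jl.
have /qa_pi_eq0 : x \in I by apply: (maxI iM IM M1); rewrite /M /= -xE.
by rewrite -xE => s00; rewrite s00 eqxx in s0.
Qed.

(** This is a norm only if the ideal is closed, which explains why the
    Gelfand-Mazur theorem is stated for seminorms. *)
Definition quotient_seminorm (s : Q) : R := inf [set nrm x | x in [set x | pi x = s]].
Local Notation q := quotient_seminorm.

Lemma quotient_seminorm_le x : q (pi x) <= nrm x.
Proof. by apply: ge_inf; [exists 0 => _ [y _ <-]; exact: nrm_ge0|exists x]. Qed.

Lemma quotient_seminorm_has_inf s : has_inf [set nrm x | x in [set x | pi x = s]].
Proof.
split; last by exists 0 => _ [y _ <-]; exact: nrm_ge0.
by have [x xE] := qa_piP s; exists (nrm x), x.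
Qed.

Lemma quotient_seminorm_ge0 s : 0 <= q s.
Proof.
by apply: lb_le_inf; [have [] := quotient_seminorm_has_inf s|move=> _ [y _ <-]; exact: nrm_ge0].
Qed.

Lemma quotient_seminorm_approx s e : 0 < e -> exists2 x, pi x = s & nrm x < q s + e.
Proof.
move=> e0; have [_ [x xE <-] h] := inf_adherent e0 (quotient_seminorm_has_inf s).
by exists x.
Qed.

Lemma quotient_seminormD s t : q (s + t) <= q s + q t.
Proof.
apply/ler_addgt0Pr => e e0; have e2 : 0 < e / 2 by rewrite divr_gt0.
have [x <- hx] := quotient_seminorm_approx s e2.
have [y <- hy] := quotient_seminorm_approx t e2.
rewrite -qa_pi_add; apply: le_trans (quotient_seminorm_le _) _.
apply: le_trans (nrmD _ _) _; lra.
Qed.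

Lemma quotient_seminormM s t : q (s * t) <= q s * q t.
Proof.
apply/ler_addgt0Pr => e e0.
have s0 := quotient_seminorm_ge0 s; have t0 := quotient_seminorm_ge0 t.
pose d := Num.min 1 (e / (q s + q t + 1)).
have D0 : 0 < q s + q t + 1 by rewrite ltr_wpDl // addr_ge0.
have d0 : 0 < d by rewrite lt_min ltr01 divr_gt0.
have d1 : d <= 1 by rewrite ge_min lexx.
have de : d * (q s + q t + 1) <= e by rewrite -ler_pdivlMr // ge_min lexx orbT.
have [x xs hx] := quotient_seminorm_approx s d0.
have [y yt hy] := quotient_seminorm_approx t d0.
rewrite -{1}xs -{1}yt -qa_pi_mul; apply: le_trans (quotient_seminorm_le _) _.
apply: le_trans (nrmM _ _) _.
apply: le_trans (ler_pM (nrm_ge0 _) (nrm_ge0 _) (ltW hx) (ltW hy)) _.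
have : d * d <= d * 1 by rewrite ler_pM2l.
lra.
Qed.

Lemma quotient_seminormZ k s : q (k *: s) = cabs k * q s.
Proof.
have half l t : q (l *: t) <= cabs l * q t.
  apply/ler_addgt0Pr => e e0.
  have D0 : 0 < cabs l + 1 by rewrite ltr_wpDl // cabs_ge0.
  have [|x xt hx] := @quotient_seminorm_approx t (e / (cabs l + 1)).
    by rewrite divr_gt0.
  rewrite -{1}xt -qa_pi_scale; apply: le_trans (quotient_seminorm_le _) _.
  rewrite nrmZ; apply: le_trans (ler_wpM2l (cabs_ge0 _) (ltW hx)) _.
  rewrite mulrDr lerD2l mulrCA ler_piMr ?(ltW e0) //.
  by rewrite ler_pdivrMr // mul1r lerDl.
apply/eqP; rewrite eq_le half /=.
have [->|k0] := eqVneq k 0.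
  by rewrite {1}/cabs normr0 mul0r quotient_seminorm_ge0.
have ck : 0 < cabs k.
  rewrite lt_neqAle cabs_ge0 andbT eq_sym; apply/eqP => ck0.
  by move/eqP: k0; apply; apply/eqP; rewrite -normr_eq0 cabsE ck0.
have := half k^-1 (k *: s); rewrite scalerA mulVf // scale1r.
rewrite -(ler_pM2l ck) mulrA -cabsM mulfV // cabs1 mul1r //.
Qed.

(** Otherwise some x with norm less than 1/2 is 1 modulo the ideal, and the
    ideal contains the invertible element 1 - x. *)
Lemma quotient_seminorm1_gt0 : 0 < q 1.
Proof.
rewrite ltNge; apply/negP => q0.
have half_gt0 : 0 < 1 / 2 :> R by lra.
have [x xE hx] := quotient_seminorm_approx 1 half_gt0.
have [|y xy] := @neumann R B x; first by lra.
suff : 1 \in I by rewrite idealr1.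
rewrite -xy; apply: ideal_mulr; apply/qa_pi_eq0.
by rewrite qa_pi_add qa_pi_opp xE qa_pi_one subrr.
Qed.

(** If z - k is never 0, it is a central element which generates Q, so it is
    invertible, and z has a resolvent on the whole plane. *)
Lemma quotient_center z : ring_center Q z -> exists k : K, z = k%:A.
Proof.
move=> zc; apply: contrapT => /forallNP nz.
have inv k : exists c, (z - k%:A) * c = 1.
  have zkc : ring_center Q (z - k%:A).
    by apply: ring_centerD => //; apply: ring_centerN => w; rewrite mulr_algl mulr_algr.
  pose J : set Q := [set b | exists c, (z - k%:A) * c = b].
  have iJ : two_sided J.
    split=> [|_ _ [c <-] [d <-]|a _ [c <-]|a _ [c <-]].
    - by exists 0; rewrite mulr0.
    - by exists (c + d); rewrite mulrDr.
    - by exists (a * c); rewrite mulrA zkc mulrA.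
    - by exists (c * a); rewrite mulrA.
  apply: (quotient_simple iJ (x := z - k%:A)); first by exists 1; rewrite mulr1.
  by rewrite subr_eq0; apply/eqP.
have [res resE] := choice inv.
apply: (@gelfand_mazur R Q q quotient_seminorm_ge0 quotient_seminormD
  quotient_seminormM quotient_seminormZ quotient_seminorm1_gt0 z res resE).
by move=> k; rewrite -[RHS](resE k) mulrBr mulrBl zc mulr_algl mulr_algr.
Qed.

Lemma quotient_iso : (forall t u v w : B, quad_defect t u v w \in I) ->
  algebra_isomorphic Q K^o \/ algebra_isomorphic Q 'M[K]_2.
Proof.
move=> defI; apply: quadratic_simple_iso.
- by move=> J iJ x Jx x0 b; exact: quotient_simple iJ x Jx x0 b.
- exact: quotient_center.
move=> t u v w.
case: (qa_piP t) (qa_piP u) (qa_piP v) (qa_piP w) => a -> [b ->] [c ->] [d ->].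
have /qa_pi_eq0 := defI a b c d.
by rewrite /quad_defect /lie_bracket !(qa_pi_add, qa_pi_opp, qa_pi_mul).
Qed.

End MaximalQuotient.

Lemma quad_defects_generate (R : realType) (B : banachAlgType R[i]) :
  ~ has_quotient_isomorphic_to B R[i]^o ->
  ~ has_quotient_isomorphic_to B 'M[R[i]]_2 ->
  generates (@quad_defects B).
Proof.
move=> noC noM2 J iJ sJ b; have [J1|J1] := pselect (J 1).
  by rewrite -[b]mulr1; case: iJ => _ _ l _; exact: l.
have [M [iM JM M1 Mmax]] := maximal_two_sided iJ J1.
have [I IE] := two_sided_ideal_of iM M1.
have [] := @quotient_iso R B I.
- move=> M' iM' IM' M'1 x M'x; rewrite IE; apply/asboolP.
  apply: (Mmax M') => // y My; apply: IM'; rewrite IE; exact/asboolP.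
- by move=> t u v w; rewrite IE; apply/asboolP/JM/sJ; exists t, u, v, w.
- by move=> iso; case: noC; exists I.
- by move=> iso; case: noM2; exists I.
Qed.

(** * The theorem *)

Theorem corollary4p1 (R : realType) (A B : banachAlgType R[i])
    (Phi : {additive A -> B})
    (Phi_lie : lie_homomorphism Phi)
    (Phi_surj : set_surj [set: A] [set: B] Phi)
    (A_noC : ~ has_quotient_isomorphic_to A R[i]^o)
    (A_noM2 : ~ has_quotient_isomorphic_to A 'M[R[i]]_2)
    (B_noC : ~ has_quotient_isomorphic_to B R[i]^o)
    (B_noM2 : ~ has_quotient_isomorphic_to B 'M[R[i]]_2)
    (B_semisimple : semisimple B) :
  exists Theta zeta : {additive A -> B},
    [/\ forall x, Phi x = Theta x + zeta x,
        set_surj [set: A] [set: B] Theta,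
        direct_sum_hom_neg_antihom Theta,
        forall x, ring_center B (zeta x) &
        vanishes_on_commutators zeta].
Proof.
have scalar_central (k : R[i]) : ring_center B k%:A.
  by move=> x; rewrite mulr_algl mulr_algr.
apply: (@lie_homomorphism_decomposition A B _ _ (2^-1)%:A) => //.
- exact: quad_defects_generate.
- by move=> n; exact: semisimple_semiprime.
- by rewrite -scalerDl (_ : 2^-1 + 2^-1 = 1 :> R[i]) ?scale1r //; field.
move=> x x3; have : (3 : R[i]) *: x = 0 by rewrite scaler_nat !mulrS addrA mulr0n addr0.
by move=> /eqP; rewrite scaler_eq0 pnatr_eq0 => /eqP.
Qed.
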